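(* Let $\Bbbk$ be a field, let $\Delta$ be a simplicial complex on $[n]$ with $\dim \Delta=1$, and let $S=\Bbbk[x_1,\dots,x_n]$. Then the sequence $(\mathrm{depth}(S/I_{\Delta}^{(\ell)}))_{\ell\geq1}$ is as follows: (i) if $\Delta$ is a matroid complex, it is $(2,2,2,\ldots)$, i.e. the depth is $2$ for all $\ell\ge 1$; (ii) if $\mathrm{diam}\,\Delta\leq2$ and $\Delta$ is not a matroid complex, it is $(2,2,1,1,\ldots)$, i.e. the depth is $2$ for $\ell=1,2$ and $1$ for all $\ell\ge 3$; (iii) if $3\leq\mathrm{diam}\,\Delta<\infty$, it is $(2,1,1,\ldots)$, i.e. the depth is $2$ for $\ell=1$ and $1$ for all $\ell\ge2$; (iv) if $\mathrm{diam}\,\Delta=\infty$, it is $(1,1,1,\ldots)$, i.e. the depth is $1$ for all $\ell\ge 1$. Moreover, if $\Delta$ is pure, then $S_{2}\text{-}\mathrm{depth}(S/I_{\Delta}^{(\ell)})=\mathrm{depth}(S/I_{\Delta}^{(\ell)})$ for all $\ell\geq1$.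
   Context: $\mathfrak m=(x_1,\dots,x_n)$ and $\omega_S$ is the canonical module of $S$. For an unmixed finitely generated graded $S$-module $M$ and $r\ge 2$, $S_r\text{-}\mathrm{depth}(M)=\min\{j : \dim K_M^j\ge j-r+1\}$, where $K_M^j=\mathrm{Hom}_{\Bbbk}(H^j_{\mathfrak m}(M),\Bbbk)\cong \mathrm{Ext}_S^{n-j}(M,\omega_S)$, $\dim$ is Krull dimension, and $\dim 0=-\infty$. A simplicial complex $\Delta$ on $[n]$ is a nonempty collection of subsets of $[n]$ closed under taking subsets; $\dim F=|F|-1$; $\Delta$ is pure if all facets have the same dimension. $\Delta$ is a matroid complex if for every $W\subset[n]$ the induced subcomplex $\Delta_W=\{F\in\Delta : F\subset W\}$ is pure. For $\dim\Delta=1$, $\mathrm{diam}\,\Delta$ is the maximal distance (minimal length of a path of edges) between two vertices of $\Delta$, and $\mathrm{diam}\,\Delta=\infty$ if $\Delta$ is disconnected. $I_\Delta\subset S$ is generated by the squarefree monomials corresponding to (minimal) non-faces of $\Delta$. For a squarefree monomial ideal $I$, $I^{(\ell)}=\bigcap_{P\in\mathrm{Ass}(I)}P^\ell$. *)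

(* Defs.v *)
From HB Require Import structures.
From mathcomp Require Import all_boot all_order all_algebra.
From mathcomp Require Import mpoly.

Set Implicit Arguments.
Unset Strict Implicit.
Unset Printing Implicit Defensive.

Import Order.TTheory GRing.Theory Num.Theory.
Local Open Scope ring_scope.

(** * Simplicial complexes on the vertex set 'I_n *)

Section Complexes.
Variable n : nat.
Implicit Types (D : {set {set 'I_n}}) (F G W : {set 'I_n}) (u v : 'I_n).

(* As usual, a vertex of D is an i with {i} \in D: not every i : 'I_n has to
   be a vertex. *)
Definition simplicial_complex D : Prop :=
  D != set0 /\ (forall F G, F \in D -> G \subset F -> G \in D).

Definition face_dim F : int := #|F|%:Z - 1.

(* The largest dimension of a face (for nonempty D). *)
Definition complex_dim D : int := (\max_(F in D) #|F|)%:Z - 1.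

Definition facet D F : bool := maxset [pred G | G \in D] F.

Definition pure D : Prop :=
  forall F G, facet D F -> facet D G -> face_dim F = face_dim G.

Definition induced D W : {set {set 'I_n}} := [set F in D | F \subset W].

Definition matroid_complex D : Prop := forall W, pure (induced D W).

Definition vertex D v : bool := [set v] \in D.

Definition edge D : rel 'I_n := [rel u v | (u != v) && ([set u; v] \in D)].

Definition walk D u v (d : nat) : bool :=
  [exists p : d.-tuple 'I_n, path (edge D) u p && (last u p == v)].

(* Minimal length of a path of edges from u to v; a shortest path has fewer
   than n edges, and the default value n only occurs if there is no path. *)
Definition distance D u v : nat := \big[minn/n]_(d < n | walk D u v d) d.

Definition connected_complex D : bool :=
  [forall u, forall v, vertex D u ==> vertex D v ==> connect (edge D) u v].

(* None stands for infinity. *)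
Definition diam D : option nat :=
  if connected_complex D
  then Some (\max_(u | vertex D u) \max_(v | vertex D v) distance D u v)
  else None.

End Complexes.

(** * Ideals of S = k[x_1, ..., x_n], as predicates *)

Section Ideals.
Variables (k : fieldType) (n : nat).
Local Notation S := {mpoly k[n]}.
Implicit Types (I J P Q G : S -> Prop) (f g h : S).

Definition is_ideal I : Prop :=
  [/\ I 0, (forall f g, I f -> I g -> I (f + g))
         & (forall f g, I g -> I (f * g))].

Definition is_prime P : Prop :=
  [/\ is_ideal P, ~ P 1 & (forall f g, P (f * g) -> P f \/ P g)].

Definition ideal_gen G : S -> Prop := fun f =>
  exists2 s : seq (S * S),
    (forall p, p \in s -> G p.2) & f = \sum_(p <- s) p.1 * p.2.

Definition ideal_mul I J : S -> Prop :=
  ideal_gen (fun h => exists f g, [/\ I f, J g & h = f * g]).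

Fixpoint ideal_pow I (l : nat) : S -> Prop :=
  if l is l'.+1 then ideal_mul I (ideal_pow I l') else fun _ => True.

Definition max_ideal : S -> Prop := ideal_gen (fun f => exists i, f = 'X_i).

(* P is an associated prime of S/I: a prime ideal that is the annihilator of
   the class of some f. *)
Definition associated_prime I P : Prop :=
  is_prime P /\ exists f, forall g, P g <-> I (g * f).

Definition symbolic_power I (l : nat) : S -> Prop := fun f =>
  forall P, associated_prime I P -> ideal_pow P l f.

Definition sqfree_monomial (F : {set 'I_n}) : S := \prod_(i in F) 'X_i.

Definition stanley_reisner (D : {set {set 'I_n}}) : S -> Prop :=
  ideal_gen (fun f => exists2 F, F \notin D & f = sqfree_monomial F).

(** * Depth of S/J *)

Definition ideal_add_seq J (s : seq S) : S -> Prop :=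
  ideal_gen (fun f => J f \/ f \in s).

(* s is a regular sequence on M = S/J, contained in the maximal ideal. *)
Definition regular_sequence J (s : seq S) : Prop :=
  [/\ (forall f, f \in s -> max_ideal f),
      (forall i, (i < size s)%N -> forall g,
          ideal_add_seq J (take i s) (s`_i * g) ->
          ideal_add_seq J (take i s) g)
    & ~ ideal_add_seq J s 1].

(* depth (S/J) = d *)
Definition is_depth J (d : nat) : Prop :=
  (exists2 s, regular_sequence J s & size s = d) /\
  (forall s, regular_sequence J s -> (size s <= d)%N).

(** * Krull dimension *)

Definition prime_chain (C : nat -> S -> Prop) (m : nat) : Prop :=
  (forall i, (i <= m)%N -> is_prime (C i)) /\
  (forall i, (i < m)%N ->
     (forall f, C i f -> C i.+1 f) /\ (exists2 f, C i.+1 f & ~ C i f)).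

(* dim (S/I) >= d, the dimension being the supremum of the lengths of chains
   of primes containing I.  For I = S there is no chain and this fails for
   every integer d, in accordance with dim 0 = -oo. *)
Definition krull_dim_ge I (d : int) : Prop :=
  exists m C,
    [/\ prime_chain C m, (forall f, I f -> C 0%N f) & d <= m%:Z].

(** * Local cohomology of S/J with support in the maximal ideal

   H^j is the cohomology of the Cech complex of M = S/J on x_1, ..., x_n, whose
   term of degree j is the direct sum of the localizations M_{x_s} over the
   s with j elements.  All the S_{x_s} are realized inside the fraction field
   of S; by exactness of localization M_{x_s} = S_{x_s} / J_{x_s}, hence the
   Cech complex of M is the quotient of the Cech complex of S by that of J. *)

Local Notation frac := {fraction S}.
Local Notation cochain := {ffun {set 'I_n} -> frac}.

Definition localized J (s : {set 'I_n}) (y : frac) : Prop :=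
  exists f t, J f /\ y = tofrac f / tofrac (sqfree_monomial s ^+ t).

Definition cech J (j : nat) (c : cochain) : Prop :=
  forall s : {set 'I_n}, if #|s| == j then localized J s (c s) else c s = 0.

Definition cech_diff (c : cochain) : cochain :=
  [ffun s : {set 'I_n} =>
     \sum_(i in s) (-1) ^+ #|[set i' in s | (i' < i)%N]| * c (s :\ i)].

Definition whole : S -> Prop := fun _ => True.

Definition cocycle J (j : nat) (z : cochain) : Prop :=
  cech whole j z /\ cech J j.+1 (cech_diff z).

Definition coboundary J (j : nat) (z : cochain) : Prop :=
  if j is j'.+1
  then exists2 b, cech whole j' b & cech J j (z - cech_diff b)
  else cech J j z.

Definition cochain_scale (f : S) (z : cochain) : cochain :=
  [ffun s => tofrac f * z s].

Definition homogeneous_frac (a : int) (y : frac) : Prop :=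
  exists f g d e,
    [/\ f \is d.-homog, g \is e.-homog, g != 0, y = tofrac f / tofrac g
      & a = d%:Z - e%:Z].

Definition homogeneous_cochain (a : int) (z : cochain) : Prop :=
  forall s, homogeneous_frac a (z s).

(* phi represents an element of K^j = Hom_k(H^j, k), the graded k-dual (the
   direct sum over a of the duals of the components of degree a of H^j), for a
   homogeneous ideal J: a k-linear form on the cocycles which vanishes on the
   coboundaries and on all but finitely many homogeneous components.  The values
   of phi outside the cocycles are irrelevant. *)
Definition dual_element J (j : nat) (phi : cochain -> k) : Prop :=
  [/\ (forall (c : k) z w, cocycle J j z -> cocycle J j w ->
         phi (cochain_scale c%:MP z + w) = c * phi z + phi w),
      (forall z, coboundary J j z -> phi z = 0)
    & (exists N : nat, forall (a : int) z,
         N%:Z < `|a| -> cocycle J j z -> homogeneous_cochain a z ->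
         phi z = 0)].

(* The annihilator of K^j, on which S acts by (f phi)(z) = phi (f z). *)
Definition dual_annihilator J (j : nat) : S -> Prop := fun f =>
  forall phi, dual_element J j phi ->
  forall z, cocycle J j z -> phi (cochain_scale f z) = 0.

(* K^j is finitely generated, so its dimension is that of S / Ann K^j. *)
Definition dual_dim_ge J (j : nat) (d : int) : Prop :=
  krull_dim_ge (dual_annihilator J j) d.

(* S_r-depth (S/J) = d *)
Definition is_Sr_depth (r : nat) J (d : nat) : Prop :=
  dual_dim_ge J d (d%:Z - r%:Z + 1) /\
  (forall j, dual_dim_ge J j (j%:Z - r%:Z + 1) -> (d <= j)%N).

End Ideals.

Arguments stanley_reisner k {n} D.

(* Main.v *)
Require Import Defs.
From HB Require Import structures.
From mathcomp Require Import all_boot all_order all_algebra.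
From mathcomp Require Import mpoly ring zify.
From Stdlib Require Import Classical ClassicalEpsilon FunctionalExtensionality PropExtensionality.

(* The symbolic power J = I_Delta^(l) is the intersection of the P_F^l over the facets F, where
   P_F = (x_i : i \notin F).  In degree a \in N^n the module H^1_m(S/J) is the reduced H^0 of
   the complex Delta_a spanned by the facets F with sum_{i \notin F} a_i < l, and when all
   facets are edges it vanishes in the other degrees; so the depth is 2 exactly when no
   Delta_a is disconnected ("cut").  An edge {u, v} belongs to Delta_a iff a_u + a_v > |a| - l.

   - Matroid: given edges uv, wz of Delta_a, if a_u is the largest of the four values, then u
     is joined to w or z by an edge of Delta_a.
   - diam <= 2 and l <= 2: a vertex of each edge is heavy enough to put all its edges in
     Delta_a, and a path of length <= 2 joins these two vertices.
   - Edge uv, vertex w adjacent to neither, l >= 3: a = e_u + (l - 2) e_v + (l - 1) e_w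
     separates uv from the star of w.
   - d(u, v) >= 3, l >= 2: a = (l - 1) (e_u + e_v) separates the stars of u and v.
   - Delta disconnected: a = 0.

   For the S_2-depth, a linear form reading off one Laurent coefficient shows that
   Ann K^2 \subset P_F for an edge F (so dim K^2 >= 1), and that Ann K^1 \subset m if there
   is a cut. *)

Set Implicit Arguments.
Unset Strict Implicit.
Unset Printing Implicit Defensive.

Import Order.TTheory GRing.Theory Num.Theory.

Open Scope ring_scope.

(** * Monomial primes and their powers *)

(** Depth is defined by regular sequences alone, so it has to be tied to H^1 by hand. The link is
    [H1_vanishes]: compatible fractions h_i / X_i^N come from one polynomial. A regular pair implies
    it. Conversely, if all facets are edges, it makes the sum of the variables and the sum of the
    edge monomials a regular pair: modulo P_F with F = {u, v} these become X_u + X_v and X_u X_v,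
    over which both variables are integral, so an element killed by the second modulo the first is
    killed by powers of all X_i. The bound depth <= 2 is cohomological too: a regular sequence of
    length 3 would lift a nonzero class of H^2 to an H^1 that vanishes. On the dual side only lower
    bounds for dimensions and the vanishing of K^0 and K^1 are needed, so one explicit functional
    suffices each time. A coefficient functional sees a single degree, hence lies in the graded
    dual. *)

Section Weights.
Variable n : nat.
Implicit Types (m : 'X_{1..n}) (T : {set 'I_n}).

Definition weight T m : nat := (\sum_(i in T) m i)%N.

Lemma weight0 T : weight T 0%MM = 0%N.
Proof. by rewrite /weight big1 // => i _; rewrite mnm0E. Qed.

Lemma weightD T : {morph weight T : m1 m2 / (m1 + m2)%MM >-> (m1 + m2)%N}.
Proof.
by move=> m1 m2; rewrite /weight -big_split; apply: eq_bigr => i _; rewrite mnmDE.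
Qed.

HB.instance Definition _ T := isMeasure.Build n (weight T) (weight0 T) (weightD T).

Lemma weight1 T i : weight T U_(i)%MM = (i \in T).
Proof.
rewrite /weight; have [iT|iT] := boolP (i \in T).
  rewrite (bigD1 i) //= mnm1E eqxx big1 ?addn0 // => j /andP[_ /negbTE ji].
  by rewrite mnm1E eq_sym ji.
rewrite big1 // => j jT; rewrite mnm1E; case: eqP => // ij.
by rewrite ij jT in iT.
Qed.

Lemma weightMn T m d : weight T (m *+ d)%MM = (weight T m * d)%N.
Proof.
by rewrite /weight big_distrl; apply: eq_bigr => i _; rewrite mulmnE.
Qed.

Lemma weightXn T i N : weight T (U_(i) *+ N)%MM = ((i \in T) * N)%N.
Proof. by rewrite weightMn weight1. Qed.

Lemma leq_weight T m i : i \in T -> (m i <= weight T m)%N.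
Proof. by move=> iT; rewrite /weight (bigD1 i) //= leq_addr. Qed.

Lemma weight_setC F m : weight setT m = (weight F m + weight (~: F) m)%N.
Proof.
rewrite /weight (bigID (mem F)) /=.
by congr (_ + _)%N; apply: eq_bigl => i; rewrite !inE.
Qed.

Lemma weight_eq0 T m : weight T m = 0%N -> forall i, i \in T -> m i = 0%N.
Proof. by move=> w0 i /(leq_weight m); rewrite w0 leqn0 => /eqP. Qed.

Lemma weight_gt0 T m : (0 < weight T m)%N -> exists2 i, i \in T & (0 < m i)%N.
Proof.
move=> w; have /existsP[i /andP[iT mi]] : [exists i, (i \in T) && (0 < m i)%N].
  apply: contraLR w => /existsPn no; rewrite -leqNgt leqn0 /weight big1 // => i iT.
  by move: (no i); rewrite iT lt0n negbK => /eqP.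
by exists i.
Qed.

Lemma weight_pigeonhole T m L :
  (#|T| * L < weight T m)%N -> exists2 i, i \in T & (L < m i)%N.
Proof.
move=> h.
have /existsP[i /andP[iT mi]] : [exists i, (i \in T) && (L < m i)%N]; last by exists i.
apply: contraLR h => /existsPn no; rewrite -leqNgt -sum_nat_const.
by apply: leq_sum => i iT; move: (no i); rewrite iT -leqNgt.
Qed.

Lemma mnm_addP m i N : (N <= m i)%N -> exists m', m = (m' + U_(i) *+ N)%MM.
Proof.
move=> h; exists (m - U_(i) *+ N)%MM; apply/mnmP => j.
rewrite mnmDE mnmBE mulmnE mnm1E subnK //.
by case: eqP => [<-|]; rewrite ?mul1n ?mul0n.
Qed.

Definition mchar (F : {set 'I_n}) : 'X_{1..n} := [multinom (i \in F : nat) | i < n].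

Lemma mcharE F i : mchar F i = (i \in F).
Proof. by rewrite mnmE. Qed.

Lemma weight_mchar T F : weight T (mchar F) = #|T :&: F|.
Proof.
rewrite /weight -sum1_card.
rewrite [RHS](eq_bigl (fun i => (i \in T) && (i \in F))); last first.
  by move=> i; rewrite inE.
by rewrite big_mkcondr; apply: eq_bigr => i _; rewrite mcharE; case: (i \in F).
Qed.

End Weights.

Section Ideals.
Variables (k : fieldType) (n : nat).
Local Notation S := {mpoly k[n]}.
Implicit Types (I J : S -> Prop) (f g h : S) (m : 'X_{1..n}) (T : {set 'I_n}).

Section IdealTheory.
Variable I : S -> Prop.
Hypothesis idI : is_ideal I.

Lemma ideal0 : I 0. Proof. by case: idI. Qed.
Lemma idealD f g : I f -> I g -> I (f + g). Proof. by case: idI => _ h _; apply: h. Qed.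
Lemma idealMl f g : I g -> I (f * g). Proof. by case: idI => _ _ h; apply: h. Qed.
Lemma idealMr f g : I f -> I (f * g). Proof. by rewrite mulrC; apply: idealMl. Qed.
Lemma idealN f : I f -> I (- f). Proof. by rewrite -mulN1r; apply: idealMl. Qed.
Lemma idealB f g : I f -> I g -> I (f - g).
Proof. by move=> If Ig; apply: idealD => //; apply: idealN. Qed.
Lemma ideal_sum (A : Type) (r : seq A) (P : pred A) (F : A -> S) :
  (forall i, P i -> I (F i)) -> I (\sum_(i <- r | P i) F i).
Proof. by move=> h; elim/big_ind: _ => //; [apply: ideal0 | apply: idealD]. Qed.
Lemma ideal_eqmod f g : I (f - g) -> I g -> I f.
Proof. by move=> fg Ig; rewrite -(subrK g f); apply: idealD. Qed.

Lemma ideal_msupp f : (forall m, m \in msupp f -> I 'X_[m]) -> I f.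
Proof.
move=> h; rewrite [f]mpolyE big_seq; elim/big_ind: _ => [||m mf].
- exact: ideal0.
- exact: idealD.
- by rewrite -mul_mpolyC; apply/idealMl/h.
Qed.

End IdealTheory.

Lemma ideal_gen_ideal (G : S -> Prop) : is_ideal (ideal_gen G).
Proof.
split=> [|f g [s sG ->] [t tG ->]|f g [s sG ->]].
- by exists [::] => //; rewrite big_nil.
- exists (s ++ t); last by rewrite big_cat.
  by move=> p; rewrite mem_cat => /orP[/sG|/tG].
- exists [seq (f * p.1, p.2) | p <- s]; first by move=> _ /mapP[p /sG ? ->].
  by rewrite big_map mulr_sumr; apply: eq_bigr => p _; rewrite mulrA.
Qed.

Lemma ideal_gen_mem (G : S -> Prop) f : G f -> ideal_gen G f.
Proof.
move=> Gf; exists [:: (1, f)]; last by rewrite big_seq1 mul1r.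
by move=> p; rewrite inE => /eqP ->.
Qed.

Lemma ideal_gen_min (G I : S -> Prop) :
  is_ideal I -> (forall f, G f -> I f) -> forall f, ideal_gen G f -> I f.
Proof.
move=> idI GI f [s sG ->]; rewrite big_seq.
by apply: ideal_sum => // p /sG /GI; apply: idealMl.
Qed.

Lemma pred_ext (I J : S -> Prop) : (forall f, I f <-> J f) -> I = J.
Proof.
by move=> h; apply: functional_extensionality => f; apply: propositional_extensionality.
Qed.

(* The [l]-th power of the prime [(x_i : i \in T)]. *)
Definition ordge T (l : nat) f : Prop := forall m, m \in msupp f -> (l <= weight T m)%N.

Lemma ordge_ideal T l : is_ideal (ordge T l).
Proof.
split=> [m|f g fl gl m|f g gl m].
- by rewrite msupp0.
- by move/msuppD_le; rewrite mem_cat => /orP[/fl|/gl].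
- move/msuppM_le/allpairsP => -[[m1 m2] [/= _ /gl h ->]].
  by rewrite weightD (leq_trans h) // leq_addl.
Qed.

Lemma ordgeM T a b f g : ordge T a f -> ordge T b g -> ordge T (a + b) (f * g).
Proof.
move=> fa gb m /msuppM_le/allpairsP[[m1 m2] [/= /fa h1 /gb h2 ->]].
by rewrite weightD leq_add.
Qed.

Lemma ordgeX T m l : ordge T l ('X_[m] : S) <-> (l <= weight T m)%N.
Proof.
rewrite /ordge msuppX; split=> [h|h m']; first by apply: h; rewrite inE.
by rewrite inE => /eqP ->.
Qed.

Lemma ordge_exp T a f l : ordge T a f -> ordge T (l * a) (f ^+ l).
Proof.
move=> fa; elim: l => [|l IH]; first by move=> m.
by rewrite exprS mulSn; apply: ordgeM.
Qed.

Lemma mcoeff_pihomog (mf : measure n) d f m :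
  (pihomog mf d f)@_m = if mf m == d then f@_m else 0.
Proof.
have mono m' : (pihomog mf d 'X_[m'] : S)@_m = if mf m == d then ('X_[m'] : S)@_m else 0.
  rewrite pihomogX mcoeffX; have [->|ne] := eqVneq m' m.
    by case: ifP; rewrite ?mcoeffX ?eqxx ?mcoeff0.
  by case: ifP; rewrite ?mcoeffX ?(negbTE ne) ?mcoeff0 if_same.
rewrite {1}[f]mpolyE (raddf_sum (pihomog mf d)) raddf_sum /=.
under eq_bigr => m' _ do rewrite linearZ /= mcoeffZ mono.
case: ifP => _; last by rewrite big1 // => m' _; rewrite mulr0.
by rewrite [f in RHS]mpolyE raddf_sum; apply: eq_bigr => m' _; rewrite /= mcoeffZ.
Qed.

Lemma ordge_low T j f : ordge T j f -> ordge T j.+1 (f - pihomog (weight T) j f).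
Proof.
move=> fj m; rewrite mcoeff_msupp mcoeffB mcoeff_pihomog.
have [_|wj] := eqVneq (weight T m) j; first by rewrite subrr eqxx.
by rewrite subr0 -mcoeff_msupp ltn_neqAle eq_sym wj => /fj.
Qed.

Lemma ordge0 T f : ordge T 0 f. Proof. by []. Qed.

Lemma ordgeW T a b f : (a <= b)%N -> ordge T b f -> ordge T a f.
Proof. by move=> ab fb m /fb; apply: leq_trans. Qed.

Lemma ordge_homog T j f : ordge T j.+1 f -> f \is j.-homog for (weight T) -> f = 0.
Proof.
move=> fj /dhomogP fh; apply/eqP; rewrite -msupp_eq0.
case E: (msupp f) => [//|m s]; have mf : m \in msupp f by rewrite E inE eqxx.
by have := fj _ mf; rewrite (fh _ mf) ltnn.
Qed.

(* Induction on [l], comparing lowest-degree parts for the grading by [weight T]. *)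
Lemma ordge_primary T l f g : ordge T l (f * g) -> ~ ordge T 1 f -> ordge T l g.
Proof.
move=> fg f1.
have f0 : pihomog (weight T) 0 f != 0.
  apply/eqP => f0; apply: f1; rewrite -[f]subr0 -f0; exact: ordge_low.
elim: l fg => [|l IH] fg; first exact: ordge0.
have gl : ordge T l g by apply: IH; apply: ordgeW fg.
have := ordge_low (@ordge0 T f); have := ordge_low gl.
set g0 := pihomog _ l g; set f' := pihomog _ 0 f => g1 f1'.
have idl := ordge_ideal T l.+1.
suff /eqP : f' * g0 = 0.
  by rewrite mulf_eq0 (negbTE f0) /= => /eqP g00; rewrite -[g]subr0 -g00.
apply: (@ordge_homog T l); last first.
  by apply: (@dhomogM _ _ (weight T) 0); apply: pihomogP.
have -> : f' * g0 = f * g - (f - f') * g - f' * (g - g0) by ring.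
apply: (idealB idl); last by apply: (idealMl idl).
by apply: (idealB idl) => //; apply: (ordgeM f1' gl).
Qed.

Lemma ordge1_coef T f : ~ ordge T 1 f -> exists2 m, m \in msupp f & weight T m = 0%N.
Proof.
move=> h; apply: NNPP => no; apply: h => m mf; rewrite lt0n.
by apply/eqP => w; apply: no; exists m.
Qed.

Lemma ordge_one T : ~ ordge T 1 (1 : S).
Proof. by rewrite -mpolyX0 ordgeX weight0. Qed.

Lemma ordge_prime T : is_prime (ordge T 1).
Proof.
split; [exact: ordge_ideal | exact: ordge_one | move=> f g fg].
by have [f1|f1] := classic (ordge T 1 f); [left | right; apply: ordge_primary fg f1].
Qed.

Lemma ordgeS T T' l f : T \subset T' -> ordge T l f -> ordge T' l f.
Proof.
move=> TT' h m /h /leq_trans; apply; rewrite /weight.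
rewrite [leqRHS](big_setID T) /= (setIidPr TT') leq_addr //.
Qed.

(** A monomial of positive weight on T has a variable of T to split off, which lowers the weight by
    one; so powers of a monomial prime can be tested monomial by monomial. *)
Lemma ideal_pow_ordge T l : ideal_pow (ordge T 1) l = ordge T l.
Proof.
elim: l => [|l IH]; first exact: pred_ext.
have -> : ideal_pow (ordge T 1) l.+1 = ideal_mul (ordge T 1) (ordge T l).
  by rewrite -IH.
apply: pred_ext => f; split.
  apply: ideal_gen_min; first exact: ordge_ideal.
  by move=> f' [g [h [g1 hl ->]]]; rewrite -add1n; apply: ordgeM.
move=> fl; apply: ideal_msupp; first exact: ideal_gen_ideal.
move=> m /fl ml; apply: ideal_gen_mem.
have [i iT mi] := weight_gt0 (leq_ltn_trans (leq0n _) ml).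
have [m' def] : exists m', m = (m' + U_(i) *+ 1)%MM by apply: mnm_addP.
rewrite mulm1n in def.
exists 'X_i, 'X_[m']; split; first by rewrite ordgeX weight1 iT.
  by rewrite ordgeX; move: ml; rewrite def weightD weight1 iT addn1.
by rewrite -mpolyXD def addmC.
Qed.

Lemma max_idealE : @max_ideal k n = ordge setT 1.
Proof.
apply: pred_ext => f; split.
  apply: ideal_gen_min; first exact: ordge_ideal.
  by move=> f' [i ->]; rewrite ordgeX weight1 inE.
move=> f1; apply: ideal_msupp; first exact: ideal_gen_ideal.
move=> m /f1 /weight_gt0[i _ mi].
have [m' ->] : exists m', m = (m' + U_(i) *+ 1)%MM by apply: mnm_addP.
rewrite mulm1n mpolyXD; apply: (idealMl (ideal_gen_ideal _)).
by apply: ideal_gen_mem; exists i.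
Qed.

(* For a family [Phi] of faces, the intersection over [F \in Phi] of the [l]-th powers of
   the primes [P_F = (x_i : i \notin F)]. *)
Definition face_ideal (Phi : {set {set 'I_n}}) (l : nat) f : Prop :=
  forall F, F \in Phi -> ordge (~: F) l f.

Lemma face_ideal_ideal Phi l : is_ideal (face_ideal Phi l).
Proof.
split=> [F _|f g fI gI F FP|f g gI F FP].
- exact: (ideal0 (ordge_ideal _ _)).
- by apply: (idealD (ordge_ideal _ _)); [apply: fI | apply: gI].
- by apply: (idealMl (ordge_ideal _ _)); apply: gI.
Qed.

Lemma sqfree_monomialE (F : {set 'I_n}) : sqfree_monomial k F = 'X_[mchar F].
Proof.
rewrite /sqfree_monomial mprodXE; congr 'X_[_]; apply/mnmP => j.
rewrite mcharE mnm_sumE; have [jF|jF] := boolP (j \in F).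
  rewrite (bigD1 j) //= mnm1E eqxx big1 // => i /andP[_ /negbTE ij].
  by rewrite mnm1E ij.
rewrite big1 // => i iF; rewrite mnm1E; case: eqP => // ij.
by rewrite -ij iF in jF.
Qed.

End Ideals.

Arguments ordge_ideal {k n} T l.
Arguments face_ideal_ideal {k n} Phi l.

(** * Symbolic powers, regular sequences *)

Section SymbolicPowers.
Variables (k : fieldType) (n : nat).
Local Notation S := {mpoly k[n]}.
Implicit Types (I J : S -> Prop) (f g h : S) (m : 'X_{1..n}) (T : {set 'I_n}).
Variable D : {set {set 'I_n}}.
Hypothesis hD : simplicial_complex D.
Local Notation Phi := [set F | facet D F].

Lemma face_in_facet F : F \in D -> exists2 G, facet D G & F \subset G.
Proof.
move=> FD; have [G mG FG] := @maxset_exists _ [pred G | G \in D] F FD.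
by exists G.
Qed.

Lemma facet_face F : facet D F -> F \in D.
Proof. by case/maxsetP. Qed.

Lemma facet_sub F G : facet D F -> facet D G -> F \subset G -> F = G.
Proof. by case/maxsetP => _ h fG FG; rewrite (h G) //; apply: facet_face. Qed.

Lemma sqfree_ordge (F G : {set 'I_n}) l :
  ordge (~: G) l (sqfree_monomial k F) <-> (l <= #|F :\: G|)%N.
Proof. by rewrite sqfree_monomialE ordgeX weight_mchar setDE setIC. Qed.

(** The support of a monomial is a non-face exactly when it sticks out of every facet, that is, when
    the monomial lies in every P_F. *)
Lemma stanley_reisnerE : stanley_reisner k D = face_ideal Phi 1.
Proof.
have [_ Dsub] := hD.
apply: pred_ext => f; split.
  apply: ideal_gen_min; first exact: face_ideal_ideal.
  move=> g [F FD ->] G; rewrite inE => fG; apply/sqfree_ordge.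
  rewrite card_gt0 setD_eq0; apply: contra FD => FG.
  by apply: (Dsub G) => //; apply: facet_face.
move=> fI; apply: ideal_msupp; first exact: ideal_gen_ideal.
move=> m mf; pose F := [set i | (0 < m i)%N].
have FD : F \notin D.
  apply/negP => /face_in_facet[G fG /subsetP FG].
  have := fI G _ m mf; rewrite inE => /(_ fG) /weight_gt0[i iG mi].
  by move: iG; rewrite inE FG // inE.
have -> : m = ((m - mchar F) + mchar F)%MM.
  by apply/mnmP => i; rewrite mnmDE mnmBE mcharE inE; case: (m i) => //= ?; lia.
rewrite mpolyXD -sqfree_monomialE; apply: (idealMl (ideal_gen_ideal _)).
by apply: ideal_gen_mem; exists F.
Qed.

Lemma facet_associated F : facet D F -> associated_prime (stanley_reisner k D) (ordge (~: F) 1).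
Proof.
move=> fF; split; first exact: ordge_prime.
(* The monomial of F lies in P_G for every facet G other than F, but not in P_F, so its annihilator
   modulo the ideal is P_F. *)
exists (sqfree_monomial k F) => g; rewrite stanley_reisnerE; split.
  move=> gF G; rewrite inE => fG; have [-> | FG] := eqVneq G F.
    exact: (idealMr (ordge_ideal _ _)).
  apply: (idealMl (ordge_ideal _ _)); apply/sqfree_ordge.
  rewrite card_gt0 setD_eq0; apply: contra FG => FG.
  by rewrite (facet_sub fF fG FG).
move=> /(_ F); rewrite inE mulrC => /(_ fF) /ordge_primary; apply.
by move/sqfree_ordge; rewrite setDv cards0.
Qed.

(** Elements outside a prime have their product outside it; this merges multipliers found facet by
    facet into a single one. *)
Lemma prime_avoid_prod (P : S -> Prop) f (s : seq {set 'I_n}) :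
  is_prime P ->
  (forall F, F \in s -> exists2 g, ~ P g & ordge (~: F) 1 (g * f)) ->
  exists2 g, ~ P g & forall F, F \in s -> ordge (~: F) 1 (g * f).
Proof.
move=> [idP P1 Pp]; elim: s => [|F s IH] h; first by exists 1.
have [g Pg gs] : exists2 g, ~ P g & forall F, F \in s -> ordge (~: F) 1 (g * f).
  by apply: IH => G Gs; apply: h; rewrite inE Gs orbT.
have [g' Pg' gF] := h F (mem_head _ _).
exists (g * g') => [/Pp[]//|G]; rewrite inE => /orP[/eqP ->|/gs gG].
  by rewrite -mulrA; apply: (idealMl (ordge_ideal _ _)).
by rewrite mulrAC; apply: (idealMr (ordge_ideal _ _)).
Qed.

(** Let P be the annihilator of f. For a facet F with f outside P_F, P is contained in P_F; if it is
    never equal, each such P_F has an element outside P. The product of these elements kills f and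
    yet lies outside P. *)
Lemma associated_facet P : associated_prime (stanley_reisner k D) P ->
  exists2 F, facet D F & P = ordge (~: F) 1.
Proof.
rewrite stanley_reisnerE => -[primeP [f Pf]]; apply: NNPP => no.
have [g Pg gI] : exists2 g, ~ P g & forall F, F \in enum Phi -> ordge (~: F) 1 (g * f).
  apply: prime_avoid_prod => // F; rewrite mem_enum inE => fF.
  have [fPF|fPF] := classic (ordge (~: F) 1 f).
    by exists 1; rewrite ?mul1r //; case: primeP.
  apply: NNPP => noG; apply: no; exists F => //.
  apply: pred_ext => g; split.
    move/Pf => /(_ F); rewrite inE mulrC => /(_ fF) /ordge_primary; exact.
  move=> gF; apply: NNPP => Pg; apply: noG; exists g => //.
  exact: (idealMr (ordge_ideal _ _)).
by apply/Pg/Pf => F FPhi; apply: gI; rewrite mem_enum.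
Qed.

Lemma symbolic_powerE l : symbolic_power (stanley_reisner k D) l = face_ideal Phi l.
Proof.
apply: pred_ext => f; split=> [h F|h P /associated_facet[F fF ->]].
  by rewrite inE => /facet_associated/h; rewrite ideal_pow_ordge.
by rewrite ideal_pow_ordge; apply: h; rewrite inE.
Qed.

End SymbolicPowers.

(** * Regular sequences and the vanishing of the first local cohomology *)

Section RegularSequences.
Variables (k : fieldType) (n : nat).
Local Notation S := {mpoly k[n]}.
Implicit Types (I J : S -> Prop) (f g h : S) (m : 'X_{1..n}) (T : {set 'I_n}).

Definition nzd I f : Prop := forall g, I (f * g) -> I g.

Definition adjoin I f : S -> Prop := fun g => exists a, I (g - f * a).

Lemma adjoin_ideal I f : is_ideal I -> is_ideal (adjoin I f).
Proof.
move=> idI; split=> [|g h [a ga] [b hb]|g h [a ha]].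
- by exists 0; rewrite mulr0 subr0; apply: ideal0.
- exists (a + b); have -> : g + h - f * (a + b) = (g - f * a) + (h - f * b) by ring.
  exact: idealD.
- exists (g * a); have -> : g * h - f * (g * a) = g * (h - f * a) by ring.
  exact: idealMl.
Qed.

Lemma adjoin_sub I f g : I g -> adjoin I f g.
Proof. by exists 0; rewrite mulr0 subr0. Qed.

Lemma adjoin_mul I f g : is_ideal I -> adjoin I f (f * g).
Proof. by move=> idI; exists g; rewrite subrr; apply: ideal0. Qed.

Lemma adjoinC I f g : adjoin (adjoin I f) g = adjoin (adjoin I g) f.
Proof.
by apply: pred_ext => h; split=> -[a [b hab]]; exists b, a; rewrite addrAC.
Qed.

Lemma ideal_add_seq_nil I : is_ideal I -> ideal_add_seq I [::] = I.
Proof.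
move=> idI; apply: pred_ext => f; split; last by move=> If; apply: ideal_gen_mem; left.
by apply: ideal_gen_min => // g [].
Qed.

Lemma ideal_add_seq_rcons I s f : ideal_add_seq I (rcons s f) = adjoin (ideal_add_seq I s) f.
Proof.
have idA t : is_ideal (ideal_add_seq I t) by apply: ideal_gen_ideal.
apply: pred_ext => g; split.
  apply: ideal_gen_min; first exact: adjoin_ideal.
  move=> h [Ih|]; first by apply/adjoin_sub/ideal_gen_mem; left.
  rewrite mem_rcons inE => /orP[/eqP ->|hs]; last by apply/adjoin_sub/ideal_gen_mem; right.
  by rewrite -[X in adjoin _ _ X]mulr1; apply: adjoin_mul.
move=> [a]; rewrite -{2}(subrK (f * a) g) => ga; apply: (idealD (idA _)); last first.
  by apply: (idealMr (idA _)); apply: ideal_gen_mem; right; rewrite mem_rcons mem_head.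
apply: ideal_gen_min ga => // h [Ih|hs]; apply: ideal_gen_mem; first by left.
by right; rewrite mem_rcons inE hs orbT.
Qed.

Lemma regular_sequence2 I s : is_ideal I -> regular_sequence I s -> (1 < size s)%N ->
  [/\ max_ideal s`_0, max_ideal s`_1, nzd I s`_0 & nzd (adjoin I s`_0) s`_1].
Proof.
move=> idI [sm sreg _] s2; have s1 : (0 < size s)%N by apply: leq_trans s2.
split; try by apply/sm/mem_nth.
  by move=> g; have := sreg 0%N s1 g; rewrite take0 ideal_add_seq_nil.
move=> g; have := sreg 1%N s2 g.
by rewrite (take_nth 0 s1) take0 ideal_add_seq_rcons ideal_add_seq_nil.
Qed.

Lemma regular_sequence3 I s : is_ideal I -> regular_sequence I s -> (2 < size s)%N ->
  max_ideal s`_2 /\ nzd (adjoin (adjoin I s`_0) s`_1) s`_2.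
Proof.
move=> idI [sm sreg _] s3; have s2 : (1 < size s)%N by apply: leq_trans s3.
have s1 : (0 < size s)%N by apply: leq_trans s2.
split; first by apply/sm/mem_nth.
move=> g; have := sreg 2%N s3 g.
rewrite (take_nth 0 s2) (take_nth 0 s1) take0 !ideal_add_seq_rcons.
by rewrite ideal_add_seq_nil.
Qed.

Lemma regular_sequence_nil I : is_ideal I -> ~ I 1 -> regular_sequence I [::].
Proof. by move=> idI I1; split=> //; rewrite ideal_add_seq_nil. Qed.

Lemma regular_sequence_rcons I s f : regular_sequence I s ->
  (forall g, I g -> max_ideal g) -> max_ideal f ->
  nzd (ideal_add_seq I s) f -> regular_sequence I (rcons s f).
Proof.
move=> [sm sreg s1] Im fm fnzd.
have m_rcons g : g \in rcons s f -> max_ideal g.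
  by rewrite mem_rcons inE => /orP[/eqP -> //|/sm].
split=> // [i|]; last first.
  have idm : is_ideal (@max_ideal k n) by rewrite max_idealE; apply: ordge_ideal.
  move=> h1; have : max_ideal (1 : S).
    by apply: ideal_gen_min h1 => // g [/Im|/m_rcons].
  by rewrite max_idealE; apply: ordge_one.
rewrite size_rcons ltnS leq_eqVlt => /orP[/eqP ->|lt_is] g.
  by rewrite -cats1 take_size_cat // nth_cat ltnn subnn /=; apply: fnzd.
by rewrite -cats1 takel_cat ?(ltnW lt_is) // nth_cat lt_is; apply: sreg.
Qed.

Section Powers.
Variable I : S -> Prop.
Hypothesis idI : is_ideal I.

Lemma nzd_exp f N : nzd I f -> nzd I (f ^+ N).
Proof.
move=> fI; elim: N => [|N IH] g; first by rewrite expr0 mul1r.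
by rewrite exprS -mulrA => /fI /IH.
Qed.

(** This half of the permutability of a regular pair holds in any ring: a relation f y = g z forces
    f to divide z, and then f cancels. *)
Lemma nzd_swap f g : nzd I f -> nzd (adjoin I f) g -> nzd (adjoin I g) f.
Proof.
move=> fI gI y [z yz].
have [z' zz'] : adjoin I f z.
  apply: gI; exists y; have -> : g * z - f * y = - (f * y - g * z) by ring.
  exact: idealN.
exists z'; apply: fI.
have -> : f * (y - g * z') = (f * y - g * z) + g * (z - f * z') by ring.
by apply: idealD => //; apply: idealMl.
Qed.

(** If g y is divisible by f^(N+1), then y = f y' by the case of f itself; cancelling f leaves g y'
    divisible by f^N, which is the induction hypothesis. *)
Lemma nzd_adjoin_exp f g N : nzd I f -> nzd (adjoin I f) g -> nzd (adjoin I (f ^+ N)) g.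
Proof.
move=> fI gI; elim: N => [|N IH] y [z yz].
  by exists y; rewrite expr0 mul1r subrr; apply: ideal0.
have [y' yy'] : adjoin I f y by apply: gI; exists (f ^+ N * z); rewrite mulrA -exprS.
have [z' y'z'] : adjoin I (f ^+ N) y'.
  apply: IH; exists z; apply: fI.
  have -> : f * (g * y' - f ^+ N * z) = (g * y - f ^+ N.+1 * z) - g * (y - f * y').
    by rewrite exprS; ring.
  by apply: idealB => //; apply: idealMl.
exists z'; have -> : y - f ^+ N.+1 * z' = (y - f * y') + f * (y' - f ^+ N * z').
  by rewrite exprS; ring.
by apply: idealD => //; apply: idealMl.
Qed.

End Powers.

(** With g adjoined first, f is still regular, so the passage from f to f^N can be made over I +
    (g). *)
Lemma nzd_adjoin2_exp I f g h N : is_ideal I -> nzd I f -> nzd (adjoin I f) g ->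
  nzd (adjoin (adjoin I f) g) h -> nzd (adjoin (adjoin I (f ^+ N)) g) h.
Proof.
move=> idI fI gI hI; rewrite adjoinC; apply: nzd_adjoin_exp.
- exact: adjoin_ideal.
- exact: nzd_swap.
- by rewrite adjoinC.
Qed.

Lemma ordge_sum_Xn T N f : ordge T (#|T| * N).+1 f ->
  exists a : 'I_n -> S, f = \sum_(i in T) a i * 'X_i ^+ N.
Proof.
pose E f := exists a : 'I_n -> S, f = \sum_(i in T) a i * 'X_i ^+ N.
have idE : is_ideal E.
  split=> [|_ _ [a ->] [b ->]|g _ [a ->]].
  - by exists (fun=> 0); rewrite big1 // => i _; rewrite mul0r.
  - exists (fun i => a i + b i); rewrite -big_split; apply: eq_bigr => i _.
    by rewrite mulrDl.
  - exists (fun i => g * a i); rewrite mulr_sumr; apply: eq_bigr => i _.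
    by rewrite mulrA.
move=> fT; apply: (ideal_msupp idE) => m /fT /weight_pigeonhole[i iT mi].
have [m' ->] := mnm_addP (ltnW mi).
exists (fun j => if j == i then 'X_[m'] else 0); rewrite (bigD1 i) //= eqxx.
rewrite big1 ?addr0 => [|j /andP[_ /negbTE ->]]; last by rewrite mul0r.
by rewrite mpolyXD mpolyXn.
Qed.

(* Vanishing of the first local cohomology module of [S/I], in terms of representatives. *)
Definition H1_vanishes I : Prop := forall N (h : 'I_n -> S),
  (forall i j, I ('X_j ^+ N * h i - 'X_i ^+ N * h j)) ->
  exists c, forall j, I (h j - 'X_j ^+ N * c).

(** Combining the h_i with the coefficients of f^K and g^K gives A and B such that A / f^K and B /
    g^K both represent the glued fraction. Hence g^K A = f^K B modulo I, and regularity of g^K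
    modulo f^K makes f^K divide A; the quotient is c. *)
Lemma regular_pair_H1 I f g : is_ideal I -> max_ideal f -> max_ideal g ->
  nzd I f -> nzd (adjoin I f) g -> H1_vanishes I.
Proof.
move=> idI; rewrite max_idealE => fm gm fI gI N h hI.
(* By pigeonhole, every monomial of degree more than n N is divisible by some X_i^N. *)
pose K := (#|[set: 'I_n]| * N).+1.
have pow u : ordge setT 1 u -> exists a : 'I_n -> S, u ^+ K = \sum_i a i * 'X_i ^+ N.
  move=> um; have [a def] := ordge_sum_Xn (T := setT) (N := N) (f := u ^+ K)
     (ordgeW (eq_leq (esym (muln1 K))) (ordge_exp um)).
  by exists a; rewrite {}def; apply: eq_bigl => i; rewrite inE.
have [a fK] := pow f fm; have [b gK] := pow g gm.
pose A := \sum_i a i * h i; pose B := \sum_i b i * h i.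
have part (u : 'I_n -> S) j :
    I ('X_j ^+ N * (\sum_i u i * h i) - (\sum_i u i * 'X_i ^+ N) * h j).
  rewrite mulr_sumr mulr_suml -sumrB; apply: ideal_sum => // i _.
  have -> : 'X_j ^+ N * (u i * h i) - u i * 'X_i ^+ N * h j =
            u i * ('X_j ^+ N * h i - 'X_i ^+ N * h j) by ring.
  exact: idealMl.
have [c Ac] : adjoin I (f ^+ K) A.
  apply: (nzd_exp (N := K) (nzd_adjoin_exp idI (N := K) fI gI)).
  exists B; rewrite gK /B !(mulr_suml, mulr_sumr) -sumrB.
  apply: ideal_sum => // j _.
  have -> : b j * 'X_j ^+ N * A - f ^+ K * (b j * h j) =
            b j * ('X_j ^+ N * A - f ^+ K * h j) by ring.
  by apply: idealMl => //; rewrite fK; apply: part.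
exists c => j; apply: (nzd_exp (N := K) fI).
have -> : f ^+ K * (h j - 'X_j ^+ N * c) =
  'X_j ^+ N * (A - f ^+ K * c) - ('X_j ^+ N * A - f ^+ K * h j) by ring.
by apply: idealB => //; [apply: idealMl | rewrite fK; apply: part].
Qed.

Lemma mcoeffXnM i N f m :
  ('X_i ^+ N * f)@_m = if (N <= m i)%N then f@_(m - U_(i) *+ N) else 0.
Proof.
rewrite mpolyXn -commr_mpolyX; case: ifP => [h|h].
  have [m' ->] := mnm_addP h; rewrite addmC mcoeffMX; congr (_@__).
  by apply/mnmP => j; rewrite mnmBE mnmDE addKn.
apply/eqP; rewrite mcoeff_eq0; apply/negP => mf.
have := perm_mem (msuppMX f (U_(i) *+ N)) m; rewrite mf => /esym/mapP[m' _ def].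
by move: h; rewrite def mnmDE mulmnE mnm1E eqxx mul1n leq_addr.
Qed.

End RegularSequences.

(** * Depth and the first local cohomology *)

Section FaceIdeals.
Variables (k : fieldType) (n : nat).
Local Notation S := {mpoly k[n]}.
Implicit Types (f g h : S) (m : 'X_{1..n}) (T A F G : {set 'I_n}).
Variables (Phi : {set {set 'I_n}}) (l : nat).
Hypothesis l_gt0 : (0 < l)%N.
Hypothesis Phi_neq0 : forall F, F \in Phi -> F != set0.
Hypothesis Phi_exists : exists F, F \in Phi.
Local Notation I := (@face_ideal k n Phi l).
Let idI : is_ideal I := face_ideal_ideal Phi l.

Lemma face_ideal_max f : I f -> max_ideal f.
Proof.
have [F FP] := Phi_exists; rewrite max_idealE => /(_ F FP) fF.
by apply: (@ordgeS _ _ (~: F)); [apply: subsetT | apply: ordgeW fF].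
Qed.

Lemma face_ideal1 : ~ I 1.
Proof. by move/face_ideal_max; rewrite max_idealE; apply: ordge_one. Qed.

Lemma Xn_notin_prime F i N : i \in F -> ~ ordge (~: F) 1 ('X_i ^+ N : S).
Proof. by move=> iF; rewrite mpolyXn ordgeX weightXn inE iF. Qed.

(** Each facet F has a vertex i; then X_i lies outside P_F and can be cancelled, since P_F^l is
    primary. *)
Lemma H0_vanishes f : (forall i, exists N, I ('X_i ^+ N * f)) -> I f.
Proof.
move=> fI F FP; have /set0Pn[i iF] := Phi_neq0 FP.
have [N fN] := fI i.
by have := fN F FP; move/ordge_primary; apply; apply: Xn_notin_prime.
Qed.

Lemma sumX_nzd : nzd I (\sum_i 'X_i).
Proof.
move=> g gI F FP; have /set0Pn[i iF] := Phi_neq0 FP.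
have := gI F FP; move/ordge_primary; apply => /(_ U_(i)%MM).
rewrite mcoeff_msupp raddf_sum (bigD1 i) //= mcoeffXU eqxx big1 => [|j ji].
  by rewrite addr0 oner_neq0 weight1 inE iF => /(_ isT).
by rewrite mcoeffXU (negbTE ji).
Qed.

Lemma sumX_max : max_ideal (\sum_i 'X_i : S).
Proof.
rewrite max_idealE; apply: (ideal_sum (ordge_ideal _ _)) => i _.
by rewrite ordgeX weight1 inE.
Qed.

Lemma depth_ge1 : regular_sequence I [:: \sum_i 'X_i].
Proof.
apply: (@regular_sequence_rcons _ _ _ [::]).
- exact: regular_sequence_nil face_ideal1.
- exact: face_ideal_max.
- exact: sumX_max.
- by rewrite ideal_add_seq_nil //; apply: sumX_nzd.
Qed.

Section TwoElementFaces.
Hypothesis Phi_card2 : forall F, F \in Phi -> #|F| = 2%N.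

(** Together with the sum of the variables this is a system of parameters: modulo each P_F the two
    become the elementary symmetric polynomials in the two variables of F. *)
Definition sum_faces : S := \sum_(F in Phi) sqfree_monomial k F.

Lemma sum_faces_max : max_ideal sum_faces.
Proof.
rewrite max_idealE; apply: (ideal_sum (ordge_ideal _ _)) => F FP.
by rewrite sqfree_monomialE ordgeX weight_mchar setTI Phi_card2.
Qed.

Lemma sumX_mod F : ordge (~: F) 1 ((\sum_i 'X_i : S) - \sum_(i in F) 'X_i).
Proof.
rewrite [X in X - _](bigID (mem F)) /= addrAC subrr add0r.
apply: (ideal_sum (ordge_ideal _ _)) => i iF.
by rewrite ordgeX weight1 inE iF.
Qed.

Lemma sum_faces_mod F : F \in Phi -> ordge (~: F) 1 (sum_faces - sqfree_monomial k F).
Proof.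
move=> FP; rewrite /sum_faces (bigD1 F) //= addrAC subrr add0r.
apply: (ideal_sum (ordge_ideal _ _)) => G /andP[GP GF].
rewrite sqfree_monomialE ordgeX weight_mchar setIC -setDE card_gt0 setD_eq0.
apply: contra GF => GF; rewrite eqEcard GF.
by rewrite (Phi_card2 GP) (Phi_card2 FP).
Qed.

(* Modulo [P_F] with [F = {u, v}], the quadratic factor is [(X_i - X_u) (X_i - X_v)]. *)
Definition vanishing_poly i : S := 'X_i * ('X_i ^+ 2 - (\sum_i 'X_i) * 'X_i + sum_faces).

Lemma vanishing_polyP i F : F \in Phi -> ordge (~: F) 1 (vanishing_poly i).
Proof.
move=> FP; have idF := ordge_ideal (k := k) (~: F) 1; rewrite /vanishing_poly.
have [iF|iF] := boolP (i \in F); last first.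
  by apply: (idealMr idF); rewrite ordgeX weight1 inE iF.
apply: (idealMl idF).
have /eqP/cards2P[u [v [uv Fuv]]] := Phi_card2 FP.
have h1 := @sumX_mod F; have h2 := @sum_faces_mod F FP.
have sF : \sum_(i in F) ('X_i : S) = 'X_u + 'X_v.
  by rewrite Fuv big_setU1 ?inE //= big_set1.
have pF : sqfree_monomial k F = 'X_u * 'X_v.
  by rewrite /sqfree_monomial Fuv big_setU1 ?inE //= big_set1.
rewrite sF in h1; rewrite pF in h2.
have root0 : ('X_i - 'X_u) * ('X_i - 'X_v) = 0 :> S.
  by move: iF; rewrite Fuv !inE => /orP[]/eqP ->; rewrite subrr ?mul0r ?mulr0.
set e := \sum_i 'X_i in h1 *.
have -> : 'X_i ^+ 2 - e * 'X_i + sum_faces =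
   ('X_i - 'X_u) * ('X_i - 'X_v) - (e - ('X_u + 'X_v)) * 'X_i + (sum_faces - 'X_u * 'X_v).
  by ring.
rewrite root0 sub0r; apply: (idealD idF) => //; apply: (idealN idF).
exact: (idealMr idF).
Qed.

(** If [sum_faces] kills g modulo I + (e), then so does X_i^(3l) for every i, say X_i^(3l) g = e h_i
    modulo I. As e is regular, the h_i are compatible and come from one c; then g - e c is killed by
    powers of all variables, hence lies in I. *)
Lemma H1_nzd : H1_vanishes I -> nzd (adjoin I (\sum_i 'X_i)) sum_faces.
Proof.
set e := \sum_i 'X_i => H1 g gJ; set J := adjoin I e in gJ *.
have idJ : is_ideal J by apply: adjoin_ideal.
(* Expanding [vanishing_poly] gives X_i^3 = p + e X_i^2 - X_i [sum_faces], and J contains both e and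
   [sum_faces] g; so X_i^3 acts on g like p, whose l-th power lies in I. *)
have eqm i t : J ('X_i ^+ (3 * t) * g - vanishing_poly i ^+ t * g).
  elim: t => [|t IH]; first by rewrite muln0 !expr0 subrr; apply: (ideal0 idJ).
  set p := vanishing_poly i in IH *.
  have -> : 'X_i ^+ (3 * t.+1) * g - p ^+ t.+1 * g =
     'X_i ^+ 3 * ('X_i ^+ (3 * t) * g - p ^+ t * g)
     + (e * ('X_i ^+ 2 * p ^+ t * g) - 'X_i * p ^+ t * (sum_faces * g)).
    rewrite mulnS exprD (exprS p t); move: (p ^+ t) => q; rewrite /p /vanishing_poly -/e; ring.
  apply: (idealD idJ); first exact: (idealMl idJ).
  apply: (idealB idJ); last exact: (idealMl idJ).
  exact: adjoin_mul.
have powI i : I (vanishing_poly i ^+ l).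
  by move=> F FP; rewrite -[X in ordge _ X]muln1; apply/ordge_exp/vanishing_polyP.
have XJ i : exists a, I ('X_i ^+ (3 * l) * g - e * a).
  change (J ('X_i ^+ (3 * l) * g)).
  apply: (ideal_eqmod idJ (eqm i l)); apply: adjoin_sub.
  exact: (idealMr idI).
have [h hI] := fin_all_exists XJ.
have [c hc] : exists c, forall j, I (h j - 'X_j ^+ (3 * l) * c).
  apply: H1 => i j; apply: sumX_nzd; rewrite -/e.
  have -> : e * ('X_j ^+ (3 * l) * h i - 'X_i ^+ (3 * l) * h j) =
     'X_i ^+ (3 * l) * ('X_j ^+ (3 * l) * g - e * h j)
      - 'X_j ^+ (3 * l) * ('X_i ^+ (3 * l) * g - e * h i) by ring.
  by apply: (idealB idI) => //; apply: (idealMl idI).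
exists c; apply: H0_vanishes => i; exists (3 * l)%N.
have -> : 'X_i ^+ (3 * l) * (g - e * c) =
  ('X_i ^+ (3 * l) * g - e * h i) + e * (h i - 'X_i ^+ (3 * l) * c) by ring.
by apply: (idealD idI) => //; apply: (idealMl idI).
Qed.

Lemma depth_ge2 : H1_vanishes I -> regular_sequence I [:: \sum_i 'X_i; sum_faces].
Proof.
move=> H1; apply: (@regular_sequence_rcons _ _ _ [:: _]).
- exact: depth_ge1.
- exact: face_ideal_max.
- exact: sum_faces_max.
- rewrite (@ideal_add_seq_rcons _ _ _ [::]) ideal_add_seq_nil //.
  exact: H1_nzd.
Qed.

End TwoElementFaces.

(* The class [w / (X_u X_v)^(l+1)] in the second local cohomology is killed by a power of a
   regular [f], so it lies in the image of the first local cohomology of [S/(I + f^K)]. *)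
Lemma depth_le2 u v f g h : u != v -> [set u; v] \in Phi ->
  (forall G, G \in Phi -> [set u; v] \subset G -> G = [set u; v]) ->
  max_ideal f -> max_ideal g -> max_ideal h ->
  nzd I f -> nzd (adjoin I f) g -> ~ nzd (adjoin (adjoin I f) g) h.
Proof.
set F := [set u; v] => uv FP Fmax; rewrite max_idealE => fm gm hm fI gI hI.
(* L exceeds the exponents l of the monomial w at u and v; K is so large that a monomial of degree K
   in X_u and X_v is divisible by X_u^L or X_v^L. The existentials keep both numbers opaque. *)
have [L defL] : exists L, L = l.+1 by exists l.+1.
have [K defK] : exists K, K = (#|F| * L).+1 by exists (#|F| * L).+1.
(* The monomial w must avoid P_F^l while w P_F lies in I. Exponent l at u and v puts it in P_G^l for
   every other G, which misses u or v; exponent l - 1 at some y outside F, if there is one, leaves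
   it one step short of P_F^l. *)
have [mw [mwu mwv mwF mwX]] : exists mw : 'X_{1..n}, [/\ mw u = l, mw v = l,
    (weight (~: F) mw < l)%N & forall j, j \notin F -> (l <= weight (~: F) (mw + U_(j))%MM)%N].
  pose base : 'X_{1..n} := [multinom (if i \in F then l else 0%N) | i < n].
  have base0 : weight (~: F) base = 0%N.
    by rewrite /weight big1 // => i; rewrite inE mnmE => /negbTE ->.
  have [/set0Pn[y]|] := boolP (~: F != set0).
    rewrite in_setC => yF; exists (base + U_(y) *+ l.-1)%MM; split.
    - rewrite mnmDE mulmnE mnm1E mnmE !inE eqxx /=.
      by case: eqP => [yu|_]; [rewrite yu !inE eqxx in yF | rewrite mul0n addn0].
    - rewrite mnmDE mulmnE mnm1E mnmE !inE eqxx orbT /=.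
      by case: eqP => [yu|_]; [rewrite yu !inE eqxx orbT in yF | rewrite mul0n addn0].
    - by rewrite weightD base0 weightXn in_setC yF mul1n add0n prednK.
    - move=> j jF; rewrite !weightD base0 weightXn weight1 !in_setC.
      by rewrite jF yF mul1n add0n addn1 prednK.
  rewrite negbK => /eqP F0; exists base; split.
  - by rewrite mnmE !inE eqxx.
  - by rewrite mnmE !inE eqxx orbT.
  - by rewrite base0.
  - by move=> j jF; have := in_setC j F; rewrite F0 jF in_set0.
pose w : S := 'X_[mw].
have uF : u \in F by rewrite !inE eqxx.
have vF : v \in F by rewrite !inE eqxx orbT.
have wF r : ordge (~: F) 1 r -> I (w * r).
  have idE : is_ideal (fun r => I (w * r)).
    split=> [|r1 r2|r1 r2]; first by rewrite mulr0; apply: (ideal0 idI).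
      by rewrite mulrDr; apply: (idealD idI).
    by rewrite mulrCA; apply: (idealMl idI).
  move=> rF; apply: (ideal_msupp idE) => m /rF /weight_gt0[j].
  rewrite in_setC => jF /mnm_addP[m' ->]; rewrite mulm1n -mpolyXD addmA (addmC mw) -addmA mpolyXD.
  apply: (idealMl idI) => // G GP; rewrite ordgeX.
  have [->|GF] := eqVneq G F; first exact: mwX.
  have [i iF iG] : exists2 i, i \in F & i \notin G.
    by apply/subsetPn; apply: contra GF => /(Fmax _ GP) ->.
  apply: leq_trans (leq_weight _ (_ : i \in ~: G)); last by rewrite inE.
  by rewrite mnmDE; move: iF; rewrite !inE => /orP[]/eqP ->; rewrite ?mwu ?mwv leq_addr.
have [p [q [r [fK rF]]]] : exists p q r,
    f ^+ K = 'X_u ^+ L * p + 'X_v ^+ L * q + r /\ ordge (~: F) 1 r.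
  pose E f := exists p q r, f = 'X_u ^+ L * p + 'X_v ^+ L * q + r /\ ordge (~: F) 1 r.
  have idF := ordge_ideal (k := k) (~: F) 1.
  have idE : is_ideal E.
    split=> [|_ _ [p1 [q1 [r1 [-> h1]]]] [p2 [q2 [r2 [-> h2]]]]|a _ [p1 [q1 [r1 [-> h1]]]]].
    - exists 0, 0, 0; split; last exact: (ideal0 idF).
      by rewrite !mulr0 !addr0.
    - exists (p1 + p2), (q1 + q2), (r1 + r2); split; last exact: (idealD idF).
      by ring.
    - exists (a * p1), (a * q1), (a * r1); split; last exact: (idealMl idF).
      by ring.
  apply: (ideal_msupp idE) => m /(ordge_exp fm (l := K)); rewrite muln1 => wm.
  have [mF|] := posnP (weight (~: F) m); last first.
    by move=> mF; exists 0, 0, 'X_[m]; rewrite !mulr0 !add0r ordgeX.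
  have [i iF mi] : exists2 i, i \in F & (L < m i)%N.
    by apply: weight_pigeonhole; move: wm; rewrite (weight_setC F) mF addn0 defK.
  have [m' ->] := mnm_addP (ltnW mi).
  move: iF; rewrite mpolyXD -mpolyXn mulrC !inE => /orP[]/eqP ->.
    by exists 'X_[m'], 0, 0; rewrite mulr0 !addr0; split=> //; apply: (ideal0 idF).
  by exists 0, 'X_[m'], 0; rewrite mulr0 add0r addr0; split=> //; apply: (ideal0 idF).
have idJ : is_ideal (adjoin I (f ^+ K)) by apply: adjoin_ideal.
have H1 : H1_vanishes (adjoin I (f ^+ K)).
  apply: (regular_pair_H1 idJ (f := g) (g := h)); rewrite ?max_idealE //.
    exact: nzd_adjoin_exp.
  exact: nzd_adjoin2_exp.
(* The fractions z_i / X_i^L differ on the overlap of u and v by w f^K / (X_u X_v)^L up to I, hence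
   are compatible modulo f^K: this lifts the class to H^1 of the quotient. *)
pose z i : S := if i == u then w * q else if i == v then - (w * p) else 0.
have zu : z u = w * q by rewrite /z eqxx.
have zv : z v = - (w * p) by rewrite /z eqxx eq_sym (negbTE uv).
have z0 i : i \notin F -> z i = 0.
  by rewrite !inE negb_or /z => /andP[/negbTE -> /negbTE ->].
have wX i s : i \notin F -> I ('X_i ^+ L * (w * s)).
  move=> iF; rewrite mulrCA; apply: wF; apply: (idealMr (ordge_ideal _ _)).
  by rewrite mpolyXn ordgeX weightXn in_setC iF mul1n defL.
have zF i j : i \in F -> j \notin F -> I ('X_j ^+ L * z i - 'X_i ^+ L * z j).
  move=> iF jF; rewrite (z0 j jF) mulr0 subr0.
  move: iF; rewrite !inE => /orP[]/eqP ->; rewrite ?zu ?zv; first exact: wX.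
  by rewrite mulrN; apply: (idealN idI) => //; apply: wX.
have zuv : adjoin I (f ^+ K) ('X_v ^+ L * z u - 'X_u ^+ L * z v).
  exists w; rewrite zu zv fK.
  have -> : 'X_v ^+ L * (w * q) - 'X_u ^+ L * - (w * p)
     - ('X_u ^+ L * p + 'X_v ^+ L * q + r) * w = - (w * r) by ring.
  by apply: (idealN idI) => //; apply: wF.
have [c cz] : exists c, forall j, adjoin I (f ^+ K) (z j - 'X_j ^+ L * c).
  apply: H1 => i j.
  have antisym a b : adjoin I (f ^+ K) ('X_b ^+ L * z a - 'X_a ^+ L * z b) ->
      adjoin I (f ^+ K) ('X_a ^+ L * z b - 'X_b ^+ L * z a).
    by move=> h1; rewrite -opprB; apply: (idealN idJ).
  have [iF|iF] := boolP (i \in F); have [jF|jF] := boolP (j \in F).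
  - move: iF jF; rewrite !inE => /orP[]/eqP -> /orP[]/eqP ->.
    + by rewrite subrr; apply: (ideal0 idJ).
    + exact: zuv.
    + exact: antisym.
    + by rewrite subrr; apply: (ideal0 idJ).
  - by apply/adjoin_sub/zF.
  - by apply/antisym/adjoin_sub/zF.
  - by rewrite !z0 // !mulr0 subrr; apply: (ideal0 idJ).
have [a au] := cz u; have [b bv] := cz v.
(* Eliminating c between the relations at u and v and cancelling f^K. At the exponent of w the two
   products contribute nothing, because l < L, so the coefficient is 1; but w is outside P_F^l. *)
have : I (w - 'X_v ^+ L * a + 'X_u ^+ L * b).
  apply: (nzd_exp (N := K) fI).
  have -> : f ^+ K * (w - 'X_v ^+ L * a + 'X_u ^+ L * b) =
     'X_v ^+ L * (w * q - 'X_u ^+ L * c - f ^+ K * a)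
     - 'X_u ^+ L * (- (w * p) - 'X_v ^+ L * c - f ^+ K * b) + w * r.
    rewrite {1}fK mulrDl mulrBr !(mulrBr _ _ (f ^+ K * _)).
    move: (f ^+ K) fK => fk ->; ring.
  rewrite zu in au; rewrite zv in bv.
  by apply: (idealD idI) => //; [apply: (idealB idI) => //; apply: (idealMl idI) | apply: wF].
move=> /(_ F FP mw); rewrite mcoeff_msupp mcoeffD mcoeffB !mcoeffXnM mwu mwv defL ltnn.
rewrite subr0 addr0 mcoeffX eqxx oner_neq0 leqNgt mwF => /(_ isT).
by [].
Qed.

Lemma depth_le2_seq u v s : u != v -> [set u; v] \in Phi ->
  (forall G, G \in Phi -> [set u; v] \subset G -> G = [set u; v]) ->
  regular_sequence I s -> (size s <= 2)%N.
Proof.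
move=> uv FP Fmax sreg; rewrite leqNgt; apply/negP => s3.
have [m0 m1 n0 n1] := regular_sequence2 idI sreg (ltnW s3).
have [m2] := regular_sequence3 idI sreg s3.
exact: (depth_le2 uv FP Fmax m0 m1 m2 n0 n1).
Qed.

Lemma depth_le1_seq s : ~ H1_vanishes I -> regular_sequence I s -> (size s <= 1)%N.
Proof.
move=> H1 sreg; rewrite leqNgt; apply/negP => s2; apply: H1.
have [m0 m1 n0 n1] := regular_sequence2 idI sreg s2.
exact: (regular_pair_H1 idI m0 m1 n0 n1).
Qed.

(* [A] separates the complex spanned by the [F] with [x^a \notin P_F^l], so its reduced
   cohomology in degree 0 (the degree [a] part of the first local cohomology) is nonzero. *)
Definition cut (a : 'X_{1..n}) A F1 F2 : Prop :=
  [/\ F1 \in Phi, F2 \in Phi,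
     (weight (~: F1) a < l)%N /\ (weight (~: F2) a < l)%N,
     F1 \subset A /\ [disjoint F2 & A]
   & forall F, F \in Phi -> (weight (~: F) a < l)%N -> F \subset A \/ [disjoint F & A]].

(** A face F with x^a outside P_F^l lies on one side of A, so it misses i or j, and the matching
    factor X_i^l or X_j^l is in P_F^l. *)
Lemma cut_separates a A F1 F2 i j : cut a A F1 F2 -> i \in A -> j \notin A ->
  I ('X_i ^+ l * ('X_j ^+ l * 'X_[a])).
Proof.
move=> [_ _ _ _ cutF] iA jA F FP; rewrite !mpolyXn -!mpolyXD ordgeX !weightD !weightXn !inE.
have [wF|] := ltnP (weight (~: F) a) l; last by move=> h; rewrite addnA (leq_trans h) ?leq_addl.
have [/subsetP FA|FA] := cutF F FP wF.
  have -> : j \notin F by apply: contra jA => /FA.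
  by rewrite mul1n addnCA leq_addr.
have -> : i \notin F by apply/negP => iF; rewrite (disjointFr FA iF) in iA.
by rewrite mul1n leq_addr.
Qed.

(** The family equal to x^a on A and to 0 elsewhere is compatible. A polynomial c inducing it would
    have coefficient 1 at x^a by a vertex of F1 and 0 by a vertex of F2. *)
Lemma cut_H1 a A F1 F2 : cut a A F1 F2 -> ~ H1_vanishes I.
Proof.
move=> cutA H1; have [F1P F2P [w1 w2] [/subsetP F1A F2A] _] := cutA.
pose h i : S := if i \in A then 'X_i ^+ l * 'X_[a] else 0.
have [c hc] : exists c, forall j, I (h j - 'X_j ^+ l * c).
  apply: (H1 l) => i j; rewrite /h.
  case: ifP => iA; case: ifP => jA.
  - by rewrite mulrCA subrr; apply: (ideal0 idI).
  - by rewrite mulr0 subr0 mulrCA; apply: (cut_separates cutA) => //; rewrite jA.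
  - rewrite mulr0 sub0r mulrCA; apply: (idealN idI) => //.
    by apply: (cut_separates cutA) => //; rewrite iA.
  - by rewrite !mulr0 subrr; apply: (ideal0 idI).
have coef F i : F \in Phi -> i \in F -> (weight (~: F) a < l)%N ->
    c@_a = (i \in A)%:R.
  move=> FP iF wF; apply/eqP; rewrite eq_sym -subr_eq0; apply/negPn/negP => nz.
  have := hc i F FP (U_(i) *+ l + a)%MM.
  rewrite mcoeff_msupp mcoeffB mcoeffXnM mnmDE mulmnE mnm1E eqxx mul1n leq_addr.
  rewrite [X in c@_X](_ : _ = a); last by apply/mnmP => j; rewrite mnmBE mnmDE addKn.
  have -> : (h i)@_(U_(i) *+ l + a) = (i \in A)%:R.
    rewrite /h; case: ifP => _; last by rewrite mcoeff0.
    by rewrite mpolyXn -mpolyXD mcoeffX eqxx.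
  by rewrite nz weightD weightXn inE iF add0n leqNgt wF => /(_ isT).
have /set0Pn[i iF] := Phi_neq0 F1P; have /set0Pn[j jF] := Phi_neq0 F2P.
have := coef F1 i F1P iF w1; rewrite (coef F2 j F2P jF w2) (F1A i iF).
by rewrite (disjointFr F2A jF) => /eqP; rewrite eq_sym oner_eq0.
Qed.

(* By connectedness, in each degree [b] the coefficients of the fractions [h i / X_i^N] agree
   for all vertices [i] of the complex spanned by the [F] with [x^b \notin P_F^l]; they are the
   coefficients of [c]. *)
Lemma no_cut_H1 : (forall F, F \in Phi -> (1 < #|F|)%N) ->
  (forall a A F1 F2, ~ cut a A F1 F2) -> H1_vanishes I.
Proof.
move=> Phi_card no_cut N h hI.
have eqh b F i j : F \in Phi -> i \in F -> j \in F -> (weight (~: F) b < l)%N ->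
    (h i)@_(b + U_(i) *+ N) = (h j)@_(b + U_(j) *+ N).
  move=> FP iF jF wF; apply/eqP; rewrite -subr_eq0; apply/negPn/negP => nz.
  have := hI i j F FP (b + U_(i) *+ N + U_(j) *+ N)%MM.
  rewrite mcoeff_msupp mcoeffB !mcoeffXnM !mnmDE !mulmnE !mnm1E !eqxx !mul1n.
  rewrite leq_addl [(N <= _)%N](_ : _ = true); last by rewrite addnAC leq_addl.
  rewrite [X in (h i)@_X](_ : _ = (b + U_(i) *+ N)%MM); last first.
    by apply/mnmP => t; rewrite mnmBE mnmDE addnK.
  rewrite [X in (h j)@_X](_ : _ = (b + U_(j) *+ N)%MM); last first.
    by apply/mnmP => t; rewrite mnmBE !mnmDE addnAC addnK.
  by rewrite nz !weightD !weightXn !inE iF jF !addn0 leqNgt wF => /(_ isT).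
have val b : exists cb, forall F i, F \in Phi -> i \in F -> (weight (~: F) b < l)%N ->
    (h i)@_(b + U_(i) *+ N) = cb.
  have [[F0 F0P w0]|no] := classic (exists2 F, F \in Phi & (weight (~: F) b < l)%N); last first.
    by exists 0 => F i FP iF wF; case: no; exists F.
  have /set0Pn[i0 iF0] := Phi_neq0 F0P; exists ((h i0)@_(b + U_(i0) *+ N)).
  (* A level set is a union of components; if it missed some F of the complex, it would be the side
     of a cut. *)
  pose A := [set i | (h i)@_(b + U_(i) *+ N) == (h i0)@_(b + U_(i0) *+ N)].
  have F0A : F0 \subset A.
    by apply/subsetP => i iF; rewrite inE; apply/eqP; apply: (eqh _ F0).
  have subA F : F \in Phi -> (weight (~: F) b < l)%N -> F \subset A \/ [disjoint F & A].
    move=> FP wF; have [|/pred0Pn[i /andP[/= iF iA]]] := boolP [disjoint F & A]; first by right.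
    left; apply/subsetP => j jF; move: iA; rewrite !inE => /eqP <-; apply/eqP.
    exact: (eqh _ F).
  move=> F i FP iF wF; have [FA|FA] := subA F FP wF.
    by move/subsetP: FA => /(_ i iF); rewrite inE => /eqP.
  by case: (no_cut b A F0 F).
pose cv b := proj1_sig (constructive_indefinite_description _ (val b)).
have cvP b F i : F \in Phi -> i \in F -> (weight (~: F) b < l)%N ->
    (h i)@_(b + U_(i) *+ N) = cv b.
  by apply: (proj2_sig (constructive_indefinite_description _ (val b))).
(* From degree d on, all coefficients of the h_i vanish, so finitely many of the values [cv] b make
   up c. *)
pose d := (\max_i msize (h i))%N.
pose c : S := \sum_(b : 'X_{1..n < d}) cv b *: 'X_[b].
have cE b F i : F \in Phi -> i \in F -> (weight (~: F) b < l)%N ->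
    (h i)@_(b + U_(i) *+ N) = c@_b.
  move=> FP iF wF; have [bd|bd] := ltnP (mdeg b) d.
    by rewrite (cvP b F i) // mcoeff_mpoly.
  have -> : c@_b = 0.
    rewrite raddf_sum big1 // => b' _; rewrite /= mcoeffZ mcoeffX.
    case: eqP => [b'b|]; last by rewrite mulr0.
    by have := bmdeg b'; rewrite b'b ltnNge bd.
  apply/memN_msupp_eq0/msize_mdeg_ge; apply: leq_trans (leq_bigmax i) (leq_trans bd _).
  by rewrite mdegD leq_addr.
exists c => j F FP m; rewrite mcoeff_msupp leqNgt; apply: contra => wF.
(* A vertex of F other than j gives a relation free of the exponent at j: if m_j < N, it says that
   the coefficient of h_j at m is 0. So degrees with a negative entry contribute nothing. *)
have [i iF ij] : exists2 i, i \in F & i != j.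
  have := Phi_card F FP; rewrite (cardsD1 j) => hF.
  have : (0 < #|F :\ j|)%N by case: (j \in F) hF => //= /ltnW.
  by rewrite card_gt0 => /set0Pn[i]; rewrite !inE => /andP[ij iF]; exists i.
have := hI i j F FP (m + U_(i) *+ N)%MM.
rewrite mcoeff_msupp !weightD weightXn inE iF addn0 leqNgt wF /= => rel.
have /eqP : ('X_j ^+ N * h i - 'X_i ^+ N * h j)@_(m + U_(i) *+ N) = 0.
  by apply/eqP/negPn/negP => /rel.
rewrite !mcoeffB !mcoeffXnM !mnmDE !mulmnE !mnm1E eqxx (negbTE ij) mul1n mul0n addn0 leq_addl.
rewrite [X in (h j)@_X](_ : _ = m); last by apply/mnmP => t; rewrite mnmBE mnmDE addnK.
case: ifP => [Nm|_]; last by rewrite sub0r subr0 oppr_eq0.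
have [b def] := mnm_addP Nm.
have wb : (weight (~: F) b < l)%N.
  by apply: leq_ltn_trans wF; rewrite def weightD leq_addr.
rewrite [X in (h i)@_X](_ : _ = (b + U_(i) *+ N)%MM); last first.
  by apply/mnmP => t; rewrite def mnmBE !mnmDE addnAC addnK.
rewrite (cE b F i) // subr_eq0 eq_sym => /eqP ->.
suff -> : (m - U_(j) *+ N)%MM = b by rewrite subrr.
by apply/mnmP => t; rewrite def mnmBE mnmDE addnK.
Qed.

End FaceIdeals.

(** * Laurent coefficients *)

Section Localization.
Variables (k : fieldType) (n : nat).
Local Notation S := {mpoly k[n]}.
Local Notation frac := {fraction S}.
Local Notation q := (@tofrac S).
Local Notation mon := (sqfree_monomial k).
Implicit Types (f g h : S) (m : 'X_{1..n}) (T A F G s : {set 'I_n}) (y : frac).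

Lemma sqfree_neq0 s t : q (mon s ^+ t) != 0.
Proof. by rewrite tofrac_eq0 expf_neq0 // sqfree_monomialE -msupp_eq0 msuppX. Qed.

Lemma sqfree_set1 (i : 'I_n) : mon [set i] = 'X_i.
Proof. by rewrite /sqfree_monomial big_set1. Qed.

Lemma sqfree_set0 : mon (set0 : {set 'I_n}) = 1.
Proof. by rewrite /sqfree_monomial big_set0. Qed.

Lemma sqfree_set2 (i j : 'I_n) : i != j -> mon [set i; j] = 'X_i * 'X_j.
Proof. by move=> ij; rewrite /sqfree_monomial big_setU1 ?inE //= big_set1. Qed.

Lemma sqfree_exp s t : mon s ^+ t = 'X_[mchar s *+ t].
Proof. by rewrite sqfree_monomialE mpolyXn. Qed.

Lemma sqfree_diff s s' : s \subset s' -> mon s' = mon s * mon (s' :\: s).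
Proof.
move=> ss'; rewrite /sqfree_monomial (big_setID s) /=.
by rewrite (setIidPr ss').
Qed.

Lemma tofrac_divE f g f' g' : q g != 0 -> q g' != 0 ->
  q f / q g = q f' / q g' <-> f * g' = f' * g.
Proof.
move=> g0 g'0; have := eqr_div (q f) (q f') g0 g'0.
rewrite -(tofracM f g') -(tofracM f' g) => e; split=> /eqP.
  by rewrite e tofrac_eq => /eqP.
by rewrite -tofrac_eq -e => /eqP.
Qed.

Lemma localizedW (J J' : S -> Prop) s s' y : is_ideal J' -> (forall f, J f -> J' f) ->
  s \subset s' -> localized J s y -> localized J' s' y.
Proof.
move=> idJ' JJ' ss' [f [t [Jf ->]]]; exists (f * mon (s' :\: s) ^+ t), t; split.
  by apply: (idealMr idJ'); apply: JJ'.
apply/tofrac_divE; rewrite ?sqfree_neq0 //.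
by rewrite (sqfree_diff ss') exprMn; ring.
Qed.

(** All large exponents are allowed, so that two elements can be given a common denominator. *)
Lemma localizedE (J : S -> Prop) s y : is_ideal J -> localized J s y ->
  exists t0, forall t, (t0 <= t)%N -> exists f, J f /\ y = q f / q (mon s ^+ t).
Proof.
move=> idJ [f [t0 [Jf ->]]]; exists t0 => t t0t.
exists (f * mon s ^+ (t - t0)); split; first exact: (idealMr idJ).
apply/tofrac_divE; rewrite ?sqfree_neq0 //.
by rewrite -mulrA -exprD subnK.
Qed.

Section LocalizedIdeal.
Variable J : S -> Prop.
Hypothesis idJ : is_ideal J.

Lemma localized0 s : localized J s 0.
Proof. by exists 0, 0%N; rewrite tofrac0 mul0r; split=> //; apply: (ideal0 idJ). Qed.

Lemma localizedD s y1 y2 : localized J s y1 -> localized J s y2 -> localized J s (y1 + y2).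
Proof.
move=> /(localizedE idJ)[t1 h1] /(localizedE idJ)[t2 h2].
have [f [Jf ->]] := h1 _ (leq_maxl t1 t2); have [g [Jg ->]] := h2 _ (leq_maxr t1 t2).
exists (f + g), (maxn t1 t2); split; first exact: (idealD idJ).
by rewrite tofracD mulrDl.
Qed.

Lemma localizedMl f s y : localized J s y -> localized J s (q f * y).
Proof.
move=> [g [t [Jg ->]]]; exists (f * g), t; split; first exact: (idealMl idJ).
by rewrite tofracM mulrA.
Qed.

Lemma localizedN s y : localized J s y -> localized J s (- y).
Proof. by move/(localizedMl (-1)); rewrite tofracN tofrac1 mulN1r. Qed.

Lemma localized_sign s t y : localized J s y -> localized J s ((-1) ^+ t * y).
Proof. by move/(localizedMl ((-1) ^+ t)); rewrite tofracXn tofracN tofrac1. Qed.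

Lemma localized_sum (I : Type) (r : seq I) (P : pred I) s (y : I -> frac) :
  (forall i, P i -> localized J s (y i)) -> localized J s (\sum_(i <- r | P i) y i).
Proof. by move=> h; elim/big_ind: _ => //; [apply: localized0 | apply: localizedD]. Qed.

Lemma localized_power s l y : J (mon s ^+ l) -> localized (@whole k n) s y -> localized J s y.
Proof.
move=> Jl [f [t [_ ->]]]; exists (f * mon s ^+ l), (t + l)%N; split.
  exact: (idealMl idJ).
apply/tofrac_divE; rewrite ?sqfree_neq0 //.
by rewrite exprD; ring.
Qed.

End LocalizedIdeal.

Lemma whole_ideal : is_ideal (@whole k n).
Proof. by split. Qed.

Lemma localized_tofrac s f : localized (@whole k n) s (q f).
Proof. by exists f, 0%N; rewrite expr0 tofrac1 divr1. Qed.

Lemma localized_whole (J : S -> Prop) s s' y :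
  s \subset s' -> localized J s y -> localized (@whole k n) s' y.
Proof. by apply: localizedW => //; apply: whole_ideal. Qed.

(* The coefficient of [x^alpha] in the Laurent polynomial [y]; junk if [y] is not one. *)
Definition lcoef (alpha : 'X_{1..n}) y : k :=
  let p := epsilon (inhabits (0 : S, 0%N)) (fun p => y = q p.1 / q (mon setT ^+ p.2)) in
  p.1@_(alpha + mchar setT *+ p.2).

(** Two representations of y, cross-multiplied, give monomial multiples of their numerators;
    comparing one coefficient shows that the choice made by [epsilon] does not matter. *)
Lemma lcoefE alpha f s t : lcoef alpha (q f / q (mon s ^+ t)) = f@_(alpha + mchar s *+ t).
Proof.
rewrite /lcoef; set P := fun p => _; set p := epsilon _ P.
have : P p.
  apply: epsilon_spec; have [g [u [_ def]]] : localized (@whole k n) setT (q f / q (mon s ^+ t)).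
    by apply: (@localized_whole (@whole k n) s); [apply: subsetT | exists f, t].
  by exists (g, u).
move=> /(tofrac_divE _ _ (sqfree_neq0 _ _) (sqfree_neq0 _ _)); rewrite !sqfree_exp => e.
have := congr1 (mcoeff (alpha + mchar s *+ t + mchar setT *+ p.2)%MM) e.
rewrite (addmC _ (mchar setT *+ p.2)%MM) mcoeffMX => ->.
rewrite (_ : (_ + (_ + _))%MM = (mchar s *+ t + (alpha + mchar setT *+ p.2))%MM).
  by rewrite mcoeffMX.
by apply/mnmP => i; rewrite !mnmDE addnA addnC [(_ + alpha i)%N]addnC.
Qed.

Lemma lcoef_linear alpha c y1 y2 : localized (@whole k n) setT y1 ->
  localized (@whole k n) setT y2 ->
  lcoef alpha (q c%:MP * y1 + y2) = c * lcoef alpha y1 + lcoef alpha y2.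
Proof.
move=> /(localizedE whole_ideal)[t1 h1] /(localizedE whole_ideal)[t2 h2].
have [f [_ ->]] := h1 _ (leq_maxl t1 t2); have [g [_ ->]] := h2 _ (leq_maxr t1 t2).
by rewrite mulrA -tofracM -mulrDl -tofracD !lcoefE mcoeffD mcoeffCM.
Qed.

Lemma lcoefD alpha y1 y2 : localized (@whole k n) setT y1 ->
  localized (@whole k n) setT y2 ->
  lcoef alpha (y1 + y2) = lcoef alpha y1 + lcoef alpha y2.
Proof.
by move=> h1 h2; have := lcoef_linear alpha 1 h1 h2; rewrite mpolyC1 tofrac1 !mul1r.
Qed.

Lemma lcoef0 alpha : lcoef alpha 0 = 0.
Proof. by have := lcoefE alpha 0 set0 0; rewrite tofrac0 mul0r mcoeff0. Qed.

Lemma lcoef_tofrac alpha f : lcoef alpha (q f) = f@_alpha.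
Proof. by have := lcoefE alpha f set0 0; rewrite expr0 tofrac1 divr1 mulm0n addm0. Qed.

Lemma pihomogM (N e : nat) f g : g \is e.-homog ->
  pihomog mdeg (N + e) (f * g) = pihomog mdeg N f * g.
Proof.
move=> ge; rewrite {1}(pihomog_partitionE (leqnn (mmeasure mdeg f))) mulr_suml raddf_sum /=.
have term i : pihomog mdeg (N + e) (pihomog mdeg i f * g) =
    if i == N then pihomog mdeg N f * g else 0.
  have hM : pihomog mdeg i f * g \is (i + e).-homog by apply: dhomogM => //; apply: pihomogP.
  case: eqP hM => [->|/eqP iN] hM; first by rewrite pihomog_dE.
  by rewrite (@pihomog_ne0 _ _ _ (i + e)) // eqn_add2r.
under eq_bigr do rewrite term.
have [Nf|Nf] := ltnP N (mmeasure mdeg f).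
  rewrite (bigD1 (Ordinal Nf)) //= eqxx big1 ?addr0 // => i.
  by rewrite -val_eqE /= => /negbTE ->.
rewrite big1 => [|i _]; last by rewrite ltn_eqF // (leq_trans (ltn_ord i)).
rewrite pihomogE big_seq_cond big1 ?mul0r // => m /andP[mf /eqP mN].
by have := mmeasure_mnm_lt (Measure.clone _ mdeg _) mf; rewrite mN ltnNge Nf.
Qed.

(** [homogeneous_frac] allows any homogeneous denominator g, so the degree of a term of y is read
    off the cross-multiplied equation: multiplication by g shifts homogeneous components by its
    degree and kills none. *)
Lemma lcoef_homog alpha (a : int) y : localized (@whole k n) setT y ->
  homogeneous_frac a y -> a != (mdeg alpha)%:Z -> lcoef alpha y = 0.
Proof.
move=> [p [t [_ ->]]] [f [g [d [e [fd ge g0 def]]]]] ->{a} /eqP ne; rewrite lcoefE.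
have g0' : q g != 0 by rewrite tofrac_eq0.
move/(tofrac_divE _ _ (sqfree_neq0 _ _) g0'): def => def.
set M := (_ + _)%MM; apply/eqP/negPn/negP => pM; apply: ne.
rewrite sqfree_exp in def.
set x := 'X_[_] in def; set X := (mchar [set: 'I_n] *+ t)%MM in x def M pM *.
have fh : f * x \is (d + mdeg X).-homog by apply: dhomogM => //; rewrite dhomogX.
have nz : pihomog mdeg (mdeg M + e) (f * x) != 0.
  rewrite -def pihomogM // mulf_neq0 //; apply: contra pM => /eqP h0.
  have := mcoeff_pihomog (Measure.clone _ mdeg _) (mdeg M) p M.
  by rewrite eqxx => <-; rewrite h0 mcoeff0.
have : (d + mdeg X = mdeg M + e)%N.
  apply/eqP/negPn/negP => ne'.
  by rewrite (pihomog_ne0 ne' fh) eqxx in nz.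
rewrite /M mdegD; lia.
Qed.

End Localization.

Arguments whole_ideal {k n}.
Arguments sqfree_neq0 {k n} s t.

(** * Local cohomology and its dual *)

Lemma fin_uniform_bound (T : finType) (P : T -> nat -> Prop) :
  (forall x t t', (t <= t')%N -> P x t -> P x t') ->
  (forall x, exists t, P x t) -> exists t, forall x, P x t.
Proof.
move=> mono /fin_all_exists[t tP]; exists (\max_x t x)%N => x.
exact: mono (leq_bigmax x) (tP x).
Qed.

Lemma sub_divE (K : fieldType) (x y a b : K) : x != 0 -> y != 0 ->
  (x * b - y * a) / (x * y) = b / y - a / x.
Proof. by move=> x0 y0; field; apply/andP. Qed.

Lemma div_mul2l_sub (K : fieldType) (x u a b : K) : x != 0 -> u != 0 ->
  (u * a - x * u * b) / (x * u) = a / x - b.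
Proof. by move=> x0 y0; field; apply/andP. Qed.

Section Cech.
Variables (k : fieldType) (n : nat).
Local Notation S := {mpoly k[n]}.
Local Notation frac := {fraction S}.
Local Notation cochain := {ffun {set 'I_n} -> frac}.
Local Notation q := (@tofrac S).
Local Notation mon := (sqfree_monomial k).
Local Notation whole := (@whole k n).
Implicit Types (f g h : S) (m : 'X_{1..n}) (T A F G s : {set 'I_n}) (y : frac).
Implicit Types (z b c : cochain).

Lemma cochain_subE z w s : (z - w) s = z s - w s.
Proof. by rewrite !ffunE. Qed.

Lemma cech_localized (J : S -> Prop) j c s : is_ideal J -> cech J j c -> localized J s (c s).
Proof.
by move=> idJ /(_ s); case: ifP => // _ ->; apply: localized0.
Qed.

Lemma cech_eq0 (J : S -> Prop) j c s : cech J j c -> #|s| != j -> c s = 0.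
Proof. by move=> /(_ s) + /negbTE ne; rewrite ne. Qed.

Lemma cech_diff_localized j c s : cech whole j c -> localized whole s (cech_diff c s).
Proof.
move=> cj; rewrite ffunE; apply: localized_sum => [|i iS]; first exact: whole_ideal.
apply: localized_sign; first exact: whole_ideal.
apply: (@localized_whole _ _ whole (s :\ i)); first exact: subD1set.
by apply: cech_localized cj; apply: whole_ideal.
Qed.

Lemma cech_diff_eq0 j c s : cech whole j c -> #|s| != j.+1 -> cech_diff c s = 0.
Proof.
move=> cj sj; rewrite ffunE big1 // => i iS.
rewrite (cech_eq0 cj) ?mulr0 //; apply: contra sj => /eqP <-.
by rewrite (cardsD1 i s) iS.
Qed.

Lemma cech_diff_cech (J : S -> Prop) j c : cech whole j c ->
  (forall s, #|s| = j.+1 -> localized J s (cech_diff c s)) -> cech J j.+1 (cech_diff c).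
Proof.
move=> cj h s; case: eqP => [|/eqP ne]; first exact: h.
exact: cech_diff_eq0 cj ne.
Qed.

Lemma cech_diff1 c i : cech_diff c [set i] = c set0.
Proof.
rewrite ffunE big_set1 setDv (_ : [set _ in _ | _] = set0) ?cards0 ?mul1r //.
by apply/setP => j; rewrite !inE; case: eqP => // ->; rewrite ltnn.
Qed.

Lemma cech_diff2 c (i j : 'I_n) : (i < j)%N -> cech_diff c [set i; j] = c [set j] - c [set i].
Proof.
move=> ij; have ne : i != j by rewrite neq_ltn ij.
rewrite ffunE big_setU1 ?inE //= big_set1.
rewrite [X in (-1) ^+ #|pred_of_set X| * c (_ :\ i)](_ : _ = set0); last first.
  apply/setP => t; rewrite !inE; case: eqP => [->|_]; first by rewrite ltnn.
  by case: eqP => [->|//]; rewrite ltnNge ltnW.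
rewrite [X in (-1) ^+ #|pred_of_set X| * c (_ :\ j)](_ : _ = [set i]); last first.
  apply/setP => t; rewrite !inE; case: eqP => [->|_]; first by rewrite ij.
  by case: eqP => [->|//]; rewrite ltnn.
rewrite cards0 cards1 expr0 expr1 mul1r mulN1r setU1K ?inE //.
congr (_ - c _); apply/setP => t; rewrite !inE.
by case: (t =P j) => [->|_]; rewrite ?orbF // (eq_sym j i) (negbTE ne).
Qed.

Lemma cech_diff2N c i j : i != j ->
  cech_diff c [set i; j] = c [set j] - c [set i] \/ cech_diff c [set i; j] = - (c [set j] - c [set i]).
Proof.
rewrite neq_ltn => /orP[ij|ji]; [left; exact: cech_diff2|right].
by rewrite setUC cech_diff2 // opprB.
Qed.

Lemma localized_diff (J : S -> Prop) c i j : is_ideal J -> i != j ->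
  localized J [set i; j] (cech_diff c [set i; j]) <->
  localized J [set i; j] (c [set j] - c [set i]).
Proof.
move=> idJ ij; have [->//|->] := cech_diff2N c ij.
by split=> /(localizedN idJ); rewrite ?opprK.
Qed.

Section Vanishing.
Variables (Phi : {set {set 'I_n}}) (l : nat).
Hypothesis l_gt0 : (0 < l)%N.
Hypothesis Phi_neq0 : forall F, F \in Phi -> F != set0.
Hypothesis Phi_exists : exists F, F \in Phi.
Local Notation I := (@face_ideal k n Phi l).
Let idI : is_ideal I := face_ideal_ideal Phi l.

Lemma cocycle0_coboundary z : cocycle I 0 z -> coboundary I 0 z.
Proof.
move=> [zw dz] s; case: eqP => [s0|/eqP s0]; last exact: cech_eq0 zw s0.
have {s0} -> : s = set0 by apply: cards0_eq.
have [f [t [_ zf]]] := cech_localized set0 whole_ideal zw.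
rewrite sqfree_set0 expr1n tofrac1 divr1 in zf.
exists f, 0%N; rewrite expr0 tofrac1 divr1; split=> //.
apply: (H0_vanishes Phi_neq0) => i.
have := cech_localized [set i] idI dz; rewrite cech_diff1 zf => -[g [u [gI def]]].
have e1 : q f = q f / q (mon (set0 : {set 'I_n}) ^+ 0) by rewrite expr0 tofrac1 divr1.
exists u; move: def; rewrite e1.
move/(tofrac_divE _ _ (sqfree_neq0 _ _) (sqfree_neq0 _ _)).
by rewrite expr0 mulr1 sqfree_set1 mulrC => ->.
Qed.

Lemma cocycle1_coboundary z : H1_vanishes I -> cocycle I 1 z -> coboundary I 1 z.
Proof.
move=> H1 [zw dz].
have [N zN] : exists N, forall i, exists f, z [set i] = q f / q (mon [set i] ^+ N).
  apply: fin_uniform_bound => [i t t' tt' [f ->]|i].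
    exists (f * mon [set i] ^+ (t' - t)); apply/tofrac_divE; rewrite ?sqfree_neq0 //.
    by rewrite -mulrA -exprD subnK.
  by have [f [t [_ ->]]] := cech_localized [set i] whole_ideal zw; exists t, f.
have [h zh] := fin_all_exists zN.
(* The cocycle relations hold in I only after inverting X_i X_j. One exponent U clears all pairs,
   and expanding each fraction by X_i^U, as in [h'] below, absorbs it. *)
have [U hU] : exists U, forall p : 'I_n * 'I_n,
    I (('X_p.1 * 'X_p.2) ^+ U * ('X_p.2 ^+ N * h p.1 - 'X_p.1 ^+ N * h p.2)).
  apply: fin_uniform_bound => [p t t' tt' ht|[i j]] /=.
    by rewrite -(subnK tt') exprD -mulrA; apply: (idealMl idI).
  have [<-|ij] := eqVneq i j; first by exists 0%N; rewrite subrr mulr0; apply: (ideal0 idI).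
  have := cech_localized [set i; j] idI dz; move/(localized_diff _ idI ij).
  rewrite !zh !sqfree_set1 => -[g [u [gI def]]]; exists u.
  have def' : q ('X_i ^+ N * h j - 'X_j ^+ N * h i) / q (mon [set i; j] ^+ N) =
      q g / q (mon [set i; j] ^+ u).
    rewrite -def sqfree_set2 // exprMn.
    have x0 (t : 'I_n) : q ('X_t ^+ N) != 0 by rewrite -sqfree_set1 sqfree_neq0.
    rewrite tofracB (tofracM _ (h j)) (tofracM _ (h i)) (tofracM ('X_i ^+ N)).
    exact: (sub_divE _ _ (x0 i) (x0 j)).
  move/(tofrac_divE _ _ (sqfree_neq0 _ _) (sqfree_neq0 _ _)): def'.
  rewrite sqfree_set2 // mulrC -opprB mulrN => e.
  by rewrite -[X in I X]opprK e; apply/(idealN idI)/(idealMr idI).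
pose h' i := 'X_i ^+ U * h i.
have [a ha] : exists a, forall j, I (h' j - 'X_j ^+ (N + U) * a).
  apply: H1 => i j; rewrite /h'.
  have -> : 'X_j ^+ (N + U) * ('X_i ^+ U * h i) - 'X_i ^+ (N + U) * ('X_j ^+ U * h j) =
     ('X_i * 'X_j) ^+ U * ('X_j ^+ N * h i - 'X_i ^+ N * h j).
    by rewrite exprMn !exprD; ring.
  exact: (hU (i, j)).
pose b : cochain := [ffun s => if s == set0 then q a else 0].
have bw : cech whole 0 b.
  move=> s; rewrite ffunE; case: ifP => [/eqP/cards0_eq ->|].
    by rewrite eqxx; apply: localized_tofrac.
  by rewrite cards_eq0 => ->.
exists b => // s; rewrite cochain_subE; case: ifP => [/cards1P[i ->]|/negbT s1]; last first.
  by rewrite (cech_eq0 zw) // (cech_diff_eq0 bw) // subrr.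
rewrite cech_diff1 ffunE eqxx zh; exists (h' i - 'X_i ^+ (N + U) * a), (N + U)%N; split=> //.
have x0 t : q ('X_i ^+ t) != 0 by rewrite -sqfree_set1 sqfree_neq0.
rewrite /h' sqfree_set1 exprD tofracB (tofracM _ (h i)) (tofracM _ a).
by rewrite (tofracM ('X_i ^+ N)) div_mul2l_sub.
Qed.

(** If the cohomology is zero, then 1 annihilates its dual, and no prime contains 1. *)
Lemma dual_dim_vanishes (J : S -> Prop) j d :
  (forall z, cocycle J j z -> coboundary J j z) -> ~ dual_dim_ge J j d.
Proof.
move=> H [m [C [[Cp _] annC _]]]; have [_ C1 _] := Cp 0%N (leq0n m).
apply/C1/annC => phi [_ phi0 _] z zJ; rewrite (_ : cochain_scale 1 z = z).
  exact/phi0/H.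
by apply/ffunP => s; rewrite ffunE tofrac1 mul1r.
Qed.

Lemma cochain_scaleE f z s : cochain_scale f z s = q f * z s.
Proof. by rewrite ffunE. Qed.

Lemma homogeneous_frac_mulX m (a : int) y : homogeneous_frac a y ->
  homogeneous_frac ((mdeg m)%:Z + a) (q 'X_[m] * y).
Proof.
move=> [f [g [d [e [fd ge g0 -> ->]]]]]; exists ('X_[m] * f), g, (mdeg m + d)%N, e.
split=> //; last by rewrite PoszD addrA.
  by apply: dhomogM => //; rewrite dhomogX.
by rewrite (tofracM 'X_[m] f) mulrA.
Qed.

Lemma ordge_coef T j f m : ordge T j f -> (weight T m < j)%N -> f@_m = 0.
Proof.
move=> fT wm; apply/eqP; rewrite mcoeff_eq0; apply/negP => /fT.
by rewrite leqNgt wm.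
Qed.

(** * The dual of the second local cohomology has dimension at least 1 *)

Section TopCohomology.
Variable F : {set 'I_n}.
Hypothesis FP : F \in Phi.
Hypothesis F2 : #|F| = 2%N.
Hypothesis Phi_card : forall G, G \in Phi -> (#|G| <= 2)%N.

(** This is the coefficient of 1 / (X_u X_v) for F = {u, v}, a residue; [lcoef] takes natural
    exponents only, hence the factor. *)
Definition top_form z : k := lcoef 0%MM (q (mon F) * z F).

(** A term from I involves variables outside F, and a term from F minus i has no pole along X_i;
    neither contributes to the residue. *)
Lemma top_form_coboundary z : coboundary I 2 z -> top_form z = 0.
Proof.
move=> [b bw zb]; rewrite /top_form.
have -> : z F = (z - cech_diff b) F + cech_diff b F by rewrite cochain_subE subrK.
have wI := @whole_ideal k n.
have l1 : localized I F ((z - cech_diff b) F) by apply: (cech_localized F idI zb).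
have l2 : localized whole F (cech_diff b F) by apply: cech_diff_localized bw.
rewrite mulrDr lcoefD; last 2 first.
- by apply: (localizedMl wI); apply: localized_whole l1; apply: subsetT.
- by apply: (localizedMl wI); apply: localized_whole l2; apply: subsetT.
have -> : lcoef 0 (q (mon F) * (z - cech_diff b) F) = 0.
  have [g [t [gI ->]]] := l1; rewrite mulrA -(tofracM (mon F) g) lcoefE.
  apply: (@ordge_coef (~: F) l); first by apply: (idealMl (ordge_ideal _ _)); apply: gI.
  by rewrite weightD weight0 weightMn weight_mchar setIC setICr cards0 mul0n.
rewrite add0r ffunE mulr_sumr.
(* [lcoef] is additive only on Laurent polynomials, so the induction carries membership along with
   the vanishing. *)
suff : forall r : seq 'I_n, localized whole F
   (\sum_(i <- r | i \in F) q (mon F) * ((-1) ^+ #|[set i' in F | (i' < i)%N]| * b (F :\ i)))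
   /\ lcoef 0 (\sum_(i <- r | i \in F)
     q (mon F) * ((-1) ^+ #|[set i' in F | (i' < i)%N]| * b (F :\ i))) = 0.
  by case/(_ (index_enum 'I_n)).
elim=> [|i r [IH1 IH2]]; first by rewrite big_nil lcoef0; split=> //; apply: localized0.
rewrite big_cons; case: ifP => // iF.
set e := (-1) ^+ _ * _.
have le : localized whole (F :\ i) e.
  by apply: (localized_sign wI); apply: (cech_localized _ wI bw).
have lF : localized whole F (q (mon F) * e).
  by apply: (localizedMl wI); apply: localized_whole le; apply: subD1set.
split; first exact: localizedD.
rewrite lcoefD; last 2 first.
- by apply: localized_whole lF; apply: subsetT.
- by apply: localized_whole IH1; apply: subsetT.
rewrite IH2 addr0; have [g [t [_ ->]]] := le; rewrite mulrA -(tofracM (mon F) g) lcoefE.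
apply: (@ordge_coef [set i] 1).
  apply: (idealMr (ordge_ideal _ _)); rewrite sqfree_monomialE ordgeX weight_mchar.
  by rewrite (setIidPl _) ?cards1 // sub1set.
rewrite weightD weight0 weightMn weight_mchar (_ : _ :&: _ = set0) ?cards0 //.
by apply/setP => j; rewrite !inE; case: eqP.
Qed.

Lemma top_form_dual : dual_element I 2 top_form.
Proof.
have wI := @whole_ideal k n.
split=> [c z w [zw _] [ww _]|z|].
- rewrite /top_form !ffunE mulrDr mulrCA lcoef_linear //.
    by apply: (localizedMl wI); apply: localized_whole (cech_localized F wI zw); apply: subsetT.
  by apply: (localizedMl wI); apply: localized_whole (cech_localized F wI ww); apply: subsetT.
- exact: top_form_coboundary.
- exists (mdeg (mchar F)) => a z Na [zw _] zh; rewrite /top_form.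
  apply: (@lcoef_homog _ _ _ ((mdeg (mchar F))%:Z + a)).
  + by apply: (localizedMl wI); apply: localized_whole (cech_localized F wI zw); apply: subsetT.
  + by rewrite sqfree_monomialE; apply: homogeneous_frac_mulX.
  + by rewrite mdeg0; apply/eqP; lia.
Qed.

(** If f has a term x^m supported on F, then multiplying the class of x^(-m) / (X_u X_v) by f gives
    residue equal to the coefficient of x^m in f. *)
Lemma top_annihilator f : dual_annihilator I 2 f -> ordge (~: F) 1 f.
Proof.
move=> fann; apply: NNPP => /ordge1_coef[m mf wm].
have wI := @whole_ideal k n.
(* With this t the truncated subtraction is exact, and x^m' over the t-th power of the monomial of F
   is the wanted Laurent monomial. *)
pose t := (mdeg m).+1; pose m' := (mchar F *+ t - (m + mchar F))%MM.
have m'E : (mchar F *+ t = m' + m + mchar F)%MM.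
  rewrite -addmA /m'; apply/mnmP => i; rewrite mnmDE mnmBE subnK // mnmDE mulmnE mcharE.
  case: (boolP (i \in F)) => iF; last by rewrite (weight_eq0 wm) ?inE.
  by rewrite mul1n addn1 ltnS /t mdegE (bigD1 i) //= leq_addr.
pose z : cochain := [ffun s => if s == F then q 'X_[m'] / q (mon F ^+ t) else 0].
have zw : cech whole 2 z.
  move=> s; rewrite ffunE; have [->|_] := eqVneq s F.
    by rewrite F2 eqxx; exists 'X_[m'], t.
  by case: ifP => // _; apply: (localized0 wI).
have zc : cocycle I 2 z.
  (* A set of three elements lies in no member of [Phi], so the l-th power of its monomial is in I
     and the localization of I there is everything. *)
  split=> //; apply: cech_diff_cech => // s s3.
  apply: (@localized_power _ _ _ idI _ l); last exact: cech_diff_localized zw.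
  move=> G GP; rewrite -[X in ordge _ X]muln1; apply: ordge_exp.
  rewrite sqfree_monomialE ordgeX weight_mchar setIC -setDE card_gt0 setD_eq0.
  by apply/negP => /subset_leq_card; rewrite s3 leqNgt ltnS Phi_card.
have := fann _ top_form_dual z zc; rewrite /top_form cochain_scaleE ffunE eqxx.
rewrite !mulrA -(tofracM (mon F) f) -(tofracM (mon F * f)) lcoefE.
have -> : mon F * f * 'X_[m'] = f * 'X_[m' + mchar F] by rewrite sqfree_monomialE mpolyXD; ring.
rewrite add0m m'E (_ : (m' + m + mchar F)%MM = (m' + mchar F + m)%MM); last first.
  by apply/mnmP => i; rewrite !mnmDE addnAC.
by move/eqP; rewrite mcoeffMX mcoeff_eq0 mf.
Qed.

Lemma Sr_depth2 : H1_vanishes I -> is_Sr_depth 2 I 2.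
Proof.
move=> H1; split; last first.
  move=> [|[|j]] //.
  - by move/dual_dim_vanishes; case=> z; apply: cocycle0_coboundary.
  - by move/dual_dim_vanishes; case=> z; apply: cocycle1_coboundary.
have /eqP/cards2P[u [v [uv Fuv]]] := F2.
(* The bound to reach is 2 - 2 + 1 = 1: the prime P_F, then P_F with X_u added. *)
exists 1%N, (fun i => if i == 0%N then ordge (~: F) 1 else ordge (~: [set v]) 1); split=> //.
  split=> [i _|i]; first by case: ifP => _; apply: ordge_prime.
  rewrite ltnS leqn0 => /eqP -> /=; split.
    by move=> f; apply: ordgeS; rewrite setCS Fuv subsetUr.
  exists 'X_u; first by rewrite ordgeX weight1 !inE uv.
  by rewrite ordgeX weight1 Fuv !inE eqxx.
by move=> f; apply: top_annihilator.
Qed.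

End TopCohomology.

(** * A cut makes the dual of the first local cohomology nonzero *)

Section FirstCohomology.
Variables (a : 'X_{1..n}) (A F1 F2 : {set 'I_n}).
Hypothesis cutA : cut Phi l a A F1 F2.

Lemma Sr_depth1 : is_Sr_depth 2 I 1.
Proof.
split; last first.
  by case=> // /dual_dim_vanishes; case=> z; apply: cocycle0_coboundary.
have [F1P F2P [w1 w2] [/subsetP F1A F2A] _] := cutA.
have /set0Pn[i iF] := Phi_neq0 F1P; have /set0Pn[j jF] := Phi_neq0 F2P.
have iA := F1A i iF; have jA := disjointFr F2A jF.
have wI := @whole_ideal k n.
(* On coboundaries both coefficients equal that of b at the empty set. On f times the indicator
   cocycle of A the form gives the constant term of f, so the annihilator lies in the maximal ideal,
   and 1 - 2 + 1 = 0 asks for no more than this one prime. *)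
pose phi (z : cochain) := lcoef a (z [set i]) - lcoef a (z [set j]).
have coefI F t y : F \in Phi -> t \in F -> (weight (~: F) a < l)%N ->
    localized I [set t] y -> lcoef a y = 0.
  move=> FP tF wF [g [u [gI ->]]]; rewrite lcoefE.
  apply: (@ordge_coef (~: F) l); first exact: gI.
  rewrite weightD weightMn weight_mchar (_ : _ :&: _ = set0) ?cards0 ?addn0 //.
  by apply/setP => s; rewrite !inE; case: eqP => [->|]; rewrite ?tF ?andbF.
have phi_dual : dual_element I 1 phi.
  have setTw t (z : cochain) : cocycle I 1 z -> localized whole setT (z [set t]).
    by move=> [zw _]; apply: localized_whole (cech_localized [set t] wI zw); apply: subsetT.
  split=> [c z w zc wc|z [b bw zb]|].
  - by rewrite /phi !ffunE !lcoef_linear ?mulrBr; [ring | apply: setTw..].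
  - have zt F t : F \in Phi -> t \in F -> (weight (~: F) a < l)%N ->
        lcoef a (z [set t]) = lcoef a (b set0).
      move=> FP tF wF.
      have l1 : localized I [set t] ((z - cech_diff b) [set t])
        by apply: (cech_localized _ idI zb).
      have -> : z [set t] = (z - cech_diff b) [set t] + b set0.
        by rewrite cochain_subE cech_diff1 subrK.
      have L1 := localized_whole (subsetT _) l1.
      have L2 := localized_whole (subsetT _) (cech_localized set0 wI bw).
      by rewrite (lcoefD a L1 L2) (coefI F t _ FP tF wF l1) add0r.
    by rewrite /phi (zt F1) // (zt F2) // subrr.
  - exists (mdeg a) => a' z Na zc zh; rewrite /phi.
    have coef0 t : lcoef a (z [set t]) = 0.
      by apply: (lcoef_homog (setTw t z zc) (zh [set t])); apply/eqP; lia.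
    by rewrite !coef0 subrr.
pose z : cochain := [ffun s : {set 'I_n} => if (#|s| == 1%N) && (s \subset A) then q 'X_[a] else 0].
have zE t : z [set t] = if t \in A then q 'X_[a] else 0 by rewrite ffunE cards1 sub1set.
have zw : cech whole 1 z.
  move=> s; rewrite ffunE; case: (#|s| == 1%N) => //=.
  by case: (s \subset A); [apply: localized_tofrac | apply: (localized0 wI)].
have zc : cocycle I 1 z.
  split=> //; apply: (cech_diff_cech zw) => s /eqP/cards2P[u [v [uv ->]]].
  apply/(localized_diff _ idI uv); rewrite !zE.
  have sep u' v' : u' \in A -> v' \notin A -> I (('X_u' * 'X_v') ^+ l * 'X_[a]).
    by move=> u'A v'A; rewrite exprMn -mulrA; apply: (cut_separates cutA).
  have loc : I (('X_u * 'X_v) ^+ l * 'X_[a]) -> localized I [set u; v] (q 'X_[a]).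
    move=> h; exists (('X_u * 'X_v) ^+ l * 'X_[a]), l; split=> //.
    by rewrite -sqfree_set2 // (tofracM _ 'X_[a]) mulrAC divff ?mul1r // sqfree_neq0.
  case: ifP => vA; case: ifP => uA.
  - by rewrite subrr; apply: (localized0 idI).
  - by rewrite subr0; apply: loc; rewrite (mulrC 'X_u); apply: sep; rewrite ?uA.
  - by rewrite sub0r; apply: (localizedN idI); apply: loc; apply: sep; rewrite ?vA.
  - by rewrite subrr; apply: (localized0 idI).
exists 0%N, (fun _ => ordge setT 1); split=> //; first by split=> // t _; apply: ordge_prime.
move=> f /(_ phi phi_dual z zc); rewrite /phi !cochain_scaleE !zE iA jA mulr0 lcoef0 subr0.
rewrite -(tofracM f) lcoef_tofrac -[X in _@_X]addm0 mcoeffMX => f0 m mf.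
rewrite lt0n; apply/eqP => m0; move: mf; rewrite mcoeff_msupp.
suff -> : m = 0%MM by rewrite f0 eqxx.
by apply/mnmP => t; rewrite mnm0E (weight_eq0 m0).
Qed.

End FirstCohomology.
End Vanishing.
End Cech.

Close Scope ring_scope.

(** * Graphs and cuts *)

Lemma bigminn_le (T : eqType) (r : seq T) (P : pred T) (F : T -> nat) x0 i :
  i \in r -> P i -> \big[minn/x0]_(j <- r | P j) F j <= F i.
Proof.
elim: r => // j r IH; rewrite inE big_cons => /orP[/eqP <- Pi|ir Pi].
  by rewrite Pi geq_minl.
by case: ifP => _; [apply: leq_trans (geq_minr _ _) (IH ir Pi) | apply: IH].
Qed.

Section Graphs.
Variables (n : nat) (D : {set {set 'I_n}}).
Hypothesis hD : simplicial_complex D.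
Hypothesis hdim : complex_dim D = 1%R.
Implicit Types (F G : {set 'I_n}) (u v w x y z : 'I_n) (a : 'X_{1..n}).
Local Notation Phi := [set F | facet D F].

Lemma face_sub F G : F \in D -> G \subset F -> G \in D.
Proof. by case: hD => _; apply. Qed.

Lemma max_face_card : \max_(F in D) #|F| = 2.
Proof. by move: hdim; rewrite /complex_dim; lia. Qed.

Lemma face_card F : F \in D -> #|F| <= 2.
Proof. by move=> FD; rewrite -max_face_card (@leq_bigmax_cond _ _ (fun F : {set 'I_n} => #|F|)). Qed.

Lemma edge_exists : exists u v, u != v /\ [set u; v] \in D.
Proof.
have [D0 _] := hD; have [F FD FE] : {F : {set 'I_n} | F \in D & \max_(G in D) #|G| = #|F|}.
  by apply: eq_bigmax_cond; rewrite card_gt0.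
move: FE; rewrite max_face_card => /esym/eqP/cards2P[u [v [uv FE]]].
by exists u, v; rewrite -FE.
Qed.

Lemma edge_facet F : F \in D -> #|F| = 2 -> facet D F.
Proof.
move=> FD F2; apply/maxsetP; split=> // G GD FG; apply/esym/eqP.
by rewrite eqEcard FG F2 face_card.
Qed.

Lemma edge_in_Phi u v : u != v -> [set u; v] \in D -> [set u; v] \in Phi.
Proof. by move=> uv uvD; rewrite inE edge_facet // cards2 uv. Qed.

Lemma Phi_neq0 F : F \in Phi -> F != set0.
Proof.
rewrite inE => fF; apply/eqP => F0; have [u [v [_ uvD]]] := edge_exists.
have [G fG uvG] := face_in_facet uvD.
have := facet_sub fF fG; rewrite F0 sub0set => /(_ isT) G0.
by move: uvG; rewrite -G0 => /subsetP/(_ u); rewrite !inE eqxx => /(_ isT).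
Qed.

Lemma Phi_exists : exists F, F \in Phi.
Proof.
by have [u [v [uv uvD]]] := edge_exists; exists [set u; v]; apply: edge_in_Phi.
Qed.

Lemma Phi_face F : F \in Phi -> F \in D.
Proof. by rewrite inE; apply: facet_face. Qed.

Lemma weight_edge u v a : u != v ->
  weight setT a = a u + a v + weight (~: [set u; v]) a.
Proof.
move=> uv; rewrite (weight_setC [set u; v]); congr (_ + _).
by rewrite /weight big_setU1 ?inE //= big_set1.
Qed.

Lemma leq_weight2 u v w z a : u != v -> w != z -> u \notin [set w; z] ->
  v \notin [set w; z] -> a u + a v + (a w + a z) <= weight setT a.
Proof.
move=> uv wz uF vF; rewrite (weight_edge a wz) addnC leq_add2l.
rewrite /weight (bigD1 u) ?in_setC //= (bigD1 v) /=; last by rewrite in_setC vF eq_sym.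
by rewrite addnA leq_addr.
Qed.

(** Otherwise {u, v} and {w} would be facets of different dimensions of the complex induced on {w,
    u, v}. *)
Lemma matroid_adjacent : matroid_complex D -> forall u v w,
  u != v -> [set u; v] \in D -> vertex D w ->
  [|| w == u, w == v, [set w; u] \in D | [set w; v] \in D].
Proof.
move=> mD u v w uv uvD wD; apply/negPn/negP; rewrite !negb_or => /and4P[wu wv wuD wvD].
pose W := [set w; u; v].
have f1 : facet (induced D W) [set u; v].
  apply/maxsetP; split=> [|G]; first by rewrite !inE uvD /W -setUA subsetUr.
  rewrite !inE => /andP[GD _] uvG; apply/esym/eqP.
  by rewrite eqEcard uvG cards2 uv face_card.
have f2 : facet (induced D W) [set w].
  apply/maxsetP; split=> [|G]; first by rewrite !inE sub1set !inE eqxx andbT.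
  rewrite !inE sub1set => /andP[GD /subsetP GW] wG; apply/setP => x; rewrite inE.
  apply/idP/eqP => [xG|-> //]; have := GW x xG; rewrite !inE -orbA => /or3P[]/eqP // xE.
    by case/negP: wuD; apply: face_sub GD _; rewrite -xE subUset !sub1set wG.
  by case/negP: wvD; apply: face_sub GD _; rewrite -xE subUset !sub1set wG.
by have := mD W _ _ f1 f2; rewrite /face_dim cards1 cards2 uv.
Qed.

(** Facets of different sizes in an induced complex must be a vertex w and an edge {u, v} not
    containing it, and w could then be enlarged by u or v. *)
Lemma adjacent_matroid : (forall u v w, u != v -> [set u; v] \in D -> vertex D w ->
  [|| w == u, w == v, [set w; u] \in D | [set w; v] \in D]) -> matroid_complex D.
Proof.
move=> adj W.
have key F G : facet (induced D W) F -> facet (induced D W) G -> ~ (#|F| < #|G|).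
  move=> fF fG FG; have := facet_face fG; rewrite inE => /andP[GD GW].
  have := facet_face fF; rewrite inE => /andP[FD FW].
  have Fmax x : x \notin F -> x \in W -> F :|: [set x] \notin D.
    move=> xF xW; apply/negP => FxD; case/maxsetP: fF => _ /(_ (F :|: [set x])).
    rewrite !inE FxD subUset FW sub1set xW => /(_ isT (subsetUl _ _)) e.
    by case/negP: xF; rewrite -e !inE eqxx orbT.
  have G2 := face_card GD.
  have [F0|F0] := posnP #|F|.
    have /card_gt0P[x xG] : 0 < #|G| by rewrite -F0.
    have := Fmax x; rewrite (cards0_eq F0) in_set0 set0U (subsetP GW) // => /(_ isT isT).
    by rewrite (face_sub GD) // sub1set.
  have /andP[/cards1P[w Fw] /cards2P[u [v [uv Guv]]]] : (#|F| == 1) && (#|G| == 2).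
    by move: FG G2 F0; clear; lia.
  have [uW vW] : u \in W /\ v \in W.
    by split; apply: (subsetP GW); rewrite Guv !inE eqxx ?orbT.
  have wG : w \notin G.
    apply/negP => wG.
    have [x xG xF] : exists2 x, x \in G & x \notin F.
      by apply/subsetPn; apply/negP => /subset_leq_card; rewrite leqNgt FG.
    have := Fmax x xF (subsetP GW x xG); rewrite (face_sub GD) //.
    by rewrite Fw subUset !sub1set wG xG.
  rewrite Guv !inE negb_or in wG; case/andP: wG => wu wv.
  have wv1 : vertex D w by rewrite /vertex -Fw.
  have := adj u v w uv; rewrite -Guv => /(_ GD wv1); rewrite (negbTE wu) (negbTE wv) /=.
  have ne t : t != w -> t \in W -> [set w; t] \notin D.
    by move=> tw tW; have := Fmax t; rewrite Fw inE; apply.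
  by rewrite (negbTE (ne u _ uW)) ?(negbTE (ne v _ vW)) // eq_sym.
move=> F G fF fG; rewrite /face_dim; congr (Posz _ - 1)%R.
by have := key F G fF fG; have := key G F fG fF; clear; lia.
Qed.

Lemma isolated_facet w : vertex D w -> (forall x, x != w -> [set w; x] \notin D) ->
  facet D [set w].
Proof.
move=> wD iso; apply/maxsetP; split=> // G GD; rewrite sub1set => wG.
apply/setP => x; rewrite inE; apply/idP/eqP => [xG|-> //].
apply/eqP/negPn/negP => xw; case/negP: (iso x xw).
by apply: face_sub GD _; rewrite subUset !sub1set wG.
Qed.

Lemma facet_card2 : (forall w, vertex D w -> exists2 x, x != w & [set w; x] \in D) ->
  forall F, F \in Phi -> #|F| = 2.
Proof.
move=> nbr F FP; have F2 := face_card (Phi_face FP).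
have /card_gt0P[w wF] : 0 < #|F| by rewrite card_gt0 Phi_neq0.
have [x xw wxD] : exists2 x, x != w & [set w; x] \in D.
  by apply/nbr/(face_sub (Phi_face FP)); rewrite sub1set.
apply/eqP; rewrite eqn_leq F2 ltnNge; apply/negP => F1.
have /eqP e : F == [set w] by rewrite eq_sym eqEcard sub1set wF cards1.
have := FP; rewrite inE => /maxsetP[_ /(_ [set w; x] wxD)]; rewrite e => h.
have : x \in [set w] by rewrite -h ?subsetUl // !inE eqxx orbT.
by rewrite inE (negbTE xw).
Qed.

Lemma pure_nbr : pure D -> forall w, vertex D w -> exists2 x, x != w & [set w; x] \in D.
Proof.
move=> pD w wD; apply: NNPP => no.
have fw : facet D [set w].
  apply: isolated_facet => // x xw; apply/negP => wx; apply: no.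
  by exists x.
have [u [v [uv uvD]]] := edge_exists.
have fuv : facet D [set u; v] by apply: edge_facet; rewrite ?cards2 ?uv.
by have := pD _ _ fw fuv; rewrite /face_dim cards1 cards2 uv.
Qed.

Lemma matroid_pure : matroid_complex D -> pure D.
Proof.
move=> /(_ setT); rewrite (_ : induced D setT = D) //.
by apply/setP => F; rewrite inE subsetT andbT.
Qed.

Lemma vertex_edge u v : [set u; v] \in D -> vertex D u.
Proof. by move/face_sub; apply; rewrite sub1set !inE eqxx. Qed.

Lemma connected_nbr : connected_complex D ->
  forall w, vertex D w -> exists2 x, x != w & [set w; x] \in D.
Proof.
move=> /forallP con w wD; have [u [v [uv uvD]]] := edge_exists.
have [t tw tD] : exists2 t, w != t & vertex D t.
  have [wu|] := eqVneq w u; last by exists u => //; apply: vertex_edge uvD.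
  by exists v; [rewrite wu | rewrite setUC in uvD; apply: vertex_edge uvD].
have := forallP (con w) t; rewrite wD tD /= => /connectP[[|x p] /=].
  by move=> _ e; rewrite e eqxx in tw.
by move=> /andP[/andP[wx wxD] _] _; exists x; rewrite // eq_sym.
Qed.

Lemma walk_distance u v : connect (edge D) u v -> walk D u v (distance D u v).
Proof.
case/connectP => p0 path0 last0; case/shortenP: path0 last0 => p pathp up _ lastp.
have sp : size p < n.
  have := max_card (mem (u :: p)); rewrite card_ord; apply: leq_trans.
  by have /card_uniqP -> := up.
have wp : walk D u v (size p).
  by apply/existsP; exists (in_tuple p); rewrite /= pathp -lastp eqxx.
have : distance D u v <= size p.
  by apply: (bigminn_le (@nat_of_ord n) n (mem_index_enum (Ordinal sp))).
rewrite /distance; set d := \big[_/_]_(_ < _ | _) _ => dp.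
(* A path without repeated vertices has fewer than n edges, so the minimum is below its default n
   and is attained. *)
suff : d = n \/ walk D u v d by case=> // dn; move: dp; rewrite dn leqNgt sp.
rewrite /d; elim/big_ind: _ => [|x y hx hy|i wi]; [by left | | by right].
by rewrite /minn; case: ifP.
Qed.

Lemma distance_le u v d : d < n -> walk D u v d -> distance D u v <= d.
Proof. by move=> dn wd; apply: (bigminn_le (@nat_of_ord n) n (mem_index_enum (Ordinal dn))). Qed.

Lemma distance_leq_n u v : distance D u v <= n.
Proof.
rewrite /distance; elim/big_ind: _ => // [x y hx hy|i _]; last exact: ltnW.
by rewrite geq_min hx.
Qed.

Lemma walk0 u v : walk D u v 0 = (u == v).
Proof.
apply/existsP/eqP => [[p]|->]; last by exists [tuple]; rewrite /= eqxx.
by rewrite (tuple0 p) /= => /eqP.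
Qed.

Lemma walkS u v d : walk D u v d.+1 = [exists x, edge D u x && walk D x v d].
Proof.
apply/existsP/existsP => [[p]|[x /andP[ux /existsP[p /andP[pp lp]]]]].
  case/tupleP: p => x p /= /andP[/andP[ux pp] lp]; exists x; rewrite ux /=.
  by apply/existsP; exists p; rewrite pp lp.
by exists [tuple of x :: p]; rewrite /= ux pp lp.
Qed.

Lemma diam_connected d : diam D = Some d -> connected_complex D.
Proof. by rewrite /diam; case: ifP. Qed.

Lemma diam_le2 d u v : diam D = Some d -> d <= 2 -> vertex D u -> vertex D v ->
  [\/ u = v, edge D u v | exists2 x, edge D u x & edge D x v].
Proof.
move=> diamD d2 uD vD; have con := diam_connected diamD.
have : walk D u v (distance D u v).
  by apply: walk_distance; have := forallP (forallP con u) v; rewrite uD vD.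
have : distance D u v <= 2.
  apply: leq_trans d2; move: diamD; rewrite /diam con => -[<-].
  have h1 := @leq_bigmax_cond _ (vertex D) (fun u => \max_(v | vertex D v) distance D u v) u uD.
  have h2 := @leq_bigmax_cond _ (vertex D) (distance D u) v vD.
  exact: leq_trans h2 h1.
case: (distance D u v) => [|[|[|//]]] _.
- by rewrite walk0 => /eqP; constructor 1.
- by rewrite walkS => /existsP[x /andP[ux]]; rewrite walk0 => /eqP <-; constructor 2.
- rewrite walkS => /existsP[x /andP[ux]]; rewrite walkS => /existsP[y /andP[xy]].
  by rewrite walk0 => /eqP <-; constructor 3; exists x.
Qed.

Lemma diam_ge3 d : diam D = Some d -> 3 <= d ->
  exists u v, [/\ vertex D u, vertex D v, u != v, ~~ edge D u v
                & forall x, edge D u x -> ~~ edge D x v].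
Proof.
move=> diamD d3; have con := diam_connected diamD.
have [u [v [uD vD duv]]] : exists u v, [/\ vertex D u, vertex D v & 3 <= distance D u v].
  apply: NNPP => no; move: d3; move: diamD; rewrite /diam con => -[<-].
  rewrite ltnNge => /negP; apply; apply/bigmax_leqP => u uD; apply/bigmax_leqP => v vD.
  by rewrite leqNgt; apply/negP => h; apply: no; exists u, v.
(* [distance] minimizes over lengths below n only; n >= 3 ensures that walks of length at most 2 are
   counted. *)
have n3 := leq_trans duv (distance_leq_n u v).
have nowalk e : e <= 2 -> ~~ walk D u v e.
  move=> e2; apply/negP => we; have := distance_le (leq_ltn_trans e2 n3) we; lia.
exists u, v; split=> //.
- by rewrite -walk0 nowalk.
- apply: contra (nowalk 1 isT) => uv; rewrite walkS; apply/existsP; exists v.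
  by rewrite uv walk0 eqxx.
- move=> x ux; apply: contra (nowalk 2 isT) => xv; rewrite walkS; apply/existsP.
  exists x; rewrite ux walkS; apply/existsP; exists v.
  by rewrite xv walk0 eqxx.
Qed.

Section Cuts.
Hypothesis Phi_card2 : forall F, F \in Phi -> #|F| = 2.

(** The weight outside an edge {x, y} is |a| - a_x - a_y, so a cut becomes a system of linear
    inequalities in vertex values, fit for [lia]. *)
Lemma cut_edges l a A F1 F2 : cut Phi l a A F1 F2 ->
  exists u v w z, [/\ u != v, w != z, [set u; v] \in D, [set w; z] \in D &
    [/\ weight (~: [set u; v]) a < l, weight (~: [set w; z]) a < l,
        (u \in A) && (v \in A), (w \notin A) && (z \notin A)
      & forall x y, x \in A -> y \notin A -> [set x; y] \in D ->
          l + (a x + a y) <= weight setT a]].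
Proof.
move=> [F1P F2P [w1 w2] [F1A F2A] sep].
have /eqP/cards2P[u [v [uv F1E]]] := Phi_card2 F1P.
have /eqP/cards2P[w [z [wz F2E]]] := Phi_card2 F2P.
exists u, v, w, z; rewrite -F1E -F2E; split; rewrite ?Phi_face //; split=> //.
- by apply/andP; split; apply: (subsetP F1A); rewrite F1E !inE eqxx ?orbT.
- by apply/andP; split; rewrite (disjointFr F2A) // F2E !inE eqxx ?orbT.
- move=> x y xA yA xyD; have xy : x != y by apply: contraNneq yA => <-.
  rewrite (weight_edge a xy) addnC leq_add2l leqNgt; apply/negP => lt.
  have [/subsetP/(_ y)|dis] := sep _ (edge_in_Phi xy xyD) lt.
    by rewrite !inE eqxx orbT (negbTE yA) => /(_ isT).
  by have := disjointFr dis (_ : x \in [set x; y]); rewrite xA !inE eqxx => /(_ isT).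
Qed.

Lemma matroid_no_cut l a A F1 F2 : matroid_complex D -> ~ cut Phi l a A F1 F2.
Proof.
move=> mD /cut_edges[u [v [w [z [uv wz uvD wzD [wt1 wt2 /andP[uA vA] /andP[wA zA] cross]]]]]].
have adj := matroid_adjacent mD.
have ne x y : x \in A -> y \notin A -> x != y.
  by move=> xA yA; apply: contraNneq yA => <-.
have e1 := weight_edge a uv; have e2 := weight_edge a wz.
have stepA x : x \in A -> vertex D x -> a w <= a x -> a z <= a x -> False.
  move=> xA xD h1 h2; have /or4P[] := adj w z x wz wzD xD.
  - by rewrite (negbTE (ne x w xA wA)).
  - by rewrite (negbTE (ne x z xA zA)).
  - by move/(cross x w xA wA); move: h1 h2 e2 wt2; clear; lia.
  - by move/(cross x z xA zA); move: h1 h2 e2 wt2; clear; lia.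
have stepB y : y \notin A -> vertex D y -> a u <= a y -> a v <= a y -> False.
  move=> yA yD h1 h2; have /or4P[] := adj u v y uv uvD yD.
  - by rewrite eq_sym (negbTE (ne u y uA yA)).
  - by rewrite eq_sym (negbTE (ne v y vA yA)).
  - by rewrite setUC => /(cross u y uA yA); move: h1 h2 e1 wt1; clear; lia.
  - by rewrite setUC => /(cross v y vA yA); move: h1 h2 e1 wt1; clear; lia.
have uD := vertex_edge uvD; have wD := vertex_edge wzD.
have vD : vertex D v by apply: (@vertex_edge v u); rewrite setUC.
have zD : vertex D z by apply: (@vertex_edge z w); rewrite setUC.
have := stepA u uA uD; have := stepA v vA vD; have := stepB w wA wD; have := stepB z zA zD.
by clear; lia.
Qed.

Lemma diam_le2_no_cut d l a A F1 F2 : diam D = Some d -> d <= 2 -> l <= 2 ->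
  ~ cut Phi l a A F1 F2.
Proof.
move=> diamD d2 l2.
move=> /cut_edges[u [v [w [z [uv wz uvD wzD [wt1 wt2 /andP[uA vA] /andP[wA zA] cross]]]]]].
have ne x y : x \in A -> y \notin A -> x != y.
  by move=> xA yA; apply: contraNneq yA => <-.
have e1 := weight_edge a uv; have e2 := weight_edge a wz.
have e3 : a u + a v + (a w + a z) <= weight setT a.
  by apply: leq_weight2; rewrite // !inE negb_or !ne.
have vD : vertex D v by apply: (@vertex_edge v u); rewrite setUC.
have zD : vertex D z by apply: (@vertex_edge z w); rewrite setUC.
(* Adding the bounds for the two edges gives |a| <= 2l - 2, which is at most l since l <= 2. If
   neither u nor v worked, both would have value at most |a| - l <= 0, and then |a| < l by the first
   bound, a contradiction. *)
have [x [xA xD wx]] : exists x, [/\ x \in A, vertex D x & weight setT a < l + a x].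
  have [h|h] := ltnP (weight setT a) (l + a u).
    by exists u; split=> //; apply: vertex_edge uvD.
  by exists v; split=> //; move: h wt1 wt2 e1 e2 e3 l2; clear; lia.
have [y [yA yD wy]] : exists y, [/\ y \notin A, vertex D y & weight setT a < l + a y].
  have [h|h] := ltnP (weight setT a) (l + a w).
    by exists w; split=> //; apply: vertex_edge wzD.
  by exists z; split=> //; move: h wt1 wt2 e1 e2 e3 l2; clear; lia.
have [xy|/andP[_ xyD]|[p /andP[_ xpD] /andP[_ pyD]]] := diam_le2 diamD d2 xD yD.
- by rewrite xy (negbTE yA) in xA.
- by have := cross x y xA yA xyD; move: wx; clear; lia.
- have [pA|pA] := boolP (p \in A).
    by have := cross p y pA yA pyD; move: wy; clear; lia.
  by have := cross x p xA pA xpD; move: wx; clear; lia.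
Qed.

(** Here l = 1, and the bounds for the two edges force a = 0; every edge of [D] then survives, so a
    path starting in A never leaves it. *)
Lemma connected_no_cut l a A F1 F2 : connected_complex D -> l <= 1 ->
  ~ cut Phi l a A F1 F2.
Proof.
move=> /forallP con l1.
move=> /cut_edges[u [v [w [z [uv wz uvD wzD [wt1 wt2 /andP[uA vA] /andP[wA zA] cross]]]]]].
have e1 := weight_edge a uv; have e2 := weight_edge a wz.
have e3 : a u + a v + (a w + a z) <= weight setT a.
  have ne x y : x \in A -> y \notin A -> x != y.
    by move=> xA yA; apply: contraNneq yA => <-.
  by apply: leq_weight2; rewrite // !inE negb_or !ne.
have nocross x y : edge D x y -> x \in A -> y \in A.
  move=> /andP[_ xyD] xA; apply/negPn/negP => yA.
  by have := cross x y xA yA xyD; move: wt1 wt2 e1 e2 e3 l1; clear; lia.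
have := forallP (con u) w; rewrite (vertex_edge uvD) (vertex_edge wzD) /=.
case/connectP => p; elim: p u uA {uv uvD wt1 cross e1 e3 con} => [|x p IH] u uA /=.
  by move=> _ e; rewrite e uA in wA.
by move=> /andP[/nocross/(_ uA) xA]; apply: IH.
Qed.

Lemma card2_weight_setT F a : F \in Phi -> exists x y,
  [/\ x != y, F = [set x; y] & weight setT a = a x + a y + weight (~: F) a].
Proof.
move=> FP; have /eqP/cards2P[x [y [xy FE]]] := Phi_card2 FP.
by exists x, y; split=> //; rewrite FE; apply: weight_edge.
Qed.

Lemma not_matroid_cut l : ~ matroid_complex D -> 3 <= l ->
  exists a A F1 F2, cut Phi l a A F1 F2.
Proof.
move=> nm l3.
have [u [v [w [uv uvD wD]]]] : exists u v w, [/\ u != v, [set u; v] \in D, vertex D w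
   & ~~ [|| w == u, w == v, [set w; u] \in D | [set w; v] \in D]].
  apply: NNPP => no; apply/nm/adjacent_matroid => u v w uv uvD wD.
  by apply/negPn/negP => h; apply: no; exists u, v, w.
rewrite !negb_or => /and4P[wu wv wuD wvD].
have [G fG wG] := face_in_facet wD; rewrite sub1set in wG.
have GP : G \in Phi by rewrite inE.
have notw F x : F \in Phi -> w \in F -> x \in F -> x \notin [set u; v].
  move=> FP wF xF; rewrite !inE; apply/negP => /orP[]/eqP xE.
    by case/negP: wuD; apply: (face_sub (Phi_face FP)); rewrite -xE subUset !sub1set wF.
  by case/negP: wvD; apply: (face_sub (Phi_face FP)); rewrite -xE subUset !sub1set wF.
(* Since |a| = 2(l - 1), a facet survives iff its vertices carry at least l - 1. The edge {u, v} and
   the facets through w do; an edge through just one of u, v, avoiding w, carries at most max(1, l -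
   2) = l - 2, as l >= 3. *)
pose a : 'X_{1..n} := (U_(u) + U_(v) *+ (l - 2) + U_(w) *+ (l - 1))%MM.
have aE x : a x = (u == x) + (v == x) * (l - 2) + (w == x) * (l - 1).
  by rewrite !mnmDE !mulmnE !mnm1E.
have aT : weight setT a = 2 * (l - 1).
  by rewrite !weightD !weightXn weight1 !inE !mul1n; move: l3; clear; lia.
exists a, [set u; v], [set u; v], G; split.
- exact: edge_in_Phi.
- exact: GP.
- split.
    have := weight_edge a uv; rewrite aT !aE !eqxx (eq_sym v u) (negbTE uv) (negbTE wu) (negbTE wv).
    by move: l3 (weight _ a); rewrite /= !mul0n mul1n; clear => l3 W; lia.
  have [x [y [xy GE wtE]]] := card2_weight_setT a GP.
  move: wG wtE; rewrite aT !aE {1}GE !inE => /orP[]/eqP <-; rewrite eqxx mul1n; move: l3; clear; lia.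
- split=> //; apply/pred0P => t; apply/negP => /= /andP[tG].
  by apply/negP; apply: notw tG.
- move=> F FP lt; have [dis|/pred0Pn[x /andP[/= xF xuv]]] := boolP [disjoint F & [set u; v]].
    by right.
  left.
  have wF : w \notin F by apply/negP => wF; have := notw F x FP wF xF; rewrite xuv.
  have small t : t \in F -> a t <= l - 2.
    move=> tF; have wt : (w == t) = false by apply: contraNF wF => /eqP ->.
    rewrite aE wt; have [<-|_] := eqVneq u t.
      by rewrite (eq_sym v) (negbTE uv) !mul0n; move: l3; clear; lia.
    by case: (v == t); rewrite /= !mul0n ?mul1n !addn0.
  have zero t : t \in F -> t \notin [set u; v] -> a t = 0.
    move=> tF; have wt : (w == t) = false by apply: contraNF wF => /eqP ->.
    by rewrite aE wt !inE negb_or !(eq_sym t) => /andP[/negbTE -> /negbTE ->].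
  have [y [z [yz FE]]] := card2_weight_setT a FP; rewrite aT => wtE.
  have yF : y \in F by rewrite FE !inE eqxx.
  have zF : z \in F by rewrite FE !inE eqxx orbT.
  have sy := small y yF; have sz := small z zF.
  rewrite FE subUset !sub1set; apply/andP; split; apply/negPn/negP => out.
    by have := zero y yF out; move: sz wtE lt l3; clear; lia.
  by have := zero z zF out; move: sy wtE lt l3; clear; lia.
Qed.

Lemma diam_ge3_cut d l : diam D = Some d -> 3 <= d -> 2 <= l ->
  exists a A F1 F2, cut Phi l a A F1 F2.
Proof.
move=> diamD d3 l2; have [u [v [uD vD uv uvE nocommon]]] := diam_ge3 diamD d3.
have [F1 fF1 uF1] := face_in_facet uD; rewrite sub1set in uF1.
have [F2 fF2 vF2] := face_in_facet vD; rewrite sub1set in vF2.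
pose a : 'X_{1..n} := (U_(u) *+ (l - 1) + U_(v) *+ (l - 1))%MM.
have aE x : a x = (u == x) * (l - 1) + (v == x) * (l - 1).
  by rewrite !mnmDE !mulmnE !mnm1E.
have aT : weight setT a = 2 * (l - 1).
  by rewrite !weightD !weightXn !inE !mul1n; move: l2; clear; lia.
(* The closed neighbourhood of u, including u itself by x = u. A facet through v cannot meet it, as
   the distance is at least 3; a facet avoiding u and v carries weight 0 and does not survive,
   because 2(l - 1) >= l. *)
pose A := [set x | [set u; x] \in D].
have inA F : F \in Phi -> u \in F -> F \subset A.
  move=> FP uF; apply/subsetP => x xF; rewrite inE.
  by apply: face_sub (Phi_face FP) _; rewrite subUset !sub1set uF.
have outA F : F \in Phi -> v \in F -> [disjoint F & A].
  move=> FP vF; apply/pred0P => x; apply/negP => /= /andP[xF]; rewrite inE => uxD.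
  have xvD : [set x; v] \in D.
    by apply: face_sub (Phi_face FP) _; rewrite subUset !sub1set xF.
  have [ux|ux] := eqVneq u x.
    by case/negP: uvE; rewrite /edge /= uv ux.
  have [xv|xv] := eqVneq x v.
    by case/negP: uvE; rewrite /edge /= uv -xv.
  by have := nocommon x; rewrite /edge /= ux uxD xv xvD => /(_ isT).
have small F x : F \in Phi -> x \in F -> (x == u) || (x == v) -> weight (~: F) a < l.
  move=> FP xF xuv; have [y [z [yz FE wtE]]] := card2_weight_setT a FP.
  have ax : l - 1 <= a x by rewrite aE; move: xuv => /orP[]/eqP ->; rewrite eqxx mul1n; clear; lia.
  by move: xF wtE; rewrite aT {1}FE !inE => /orP[]/eqP <-; move: ax l2; clear; lia.
exists a, A, F1, F2; split; rewrite ?inE //.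
- by split; [apply: (small F1 u) | apply: (small F2 v)]; rewrite ?inE ?eqxx ?orbT.
- by split; [apply: inA | apply: outA]; rewrite ?inE.
- move=> F FP lt; have [uF|uF] := boolP (u \in F); first by left; apply: inA.
  have [vF|vF] := boolP (v \in F); first by right; apply: outA.
  have [y [z [yz FE wtE]]] := card2_weight_setT a FP.
  have a0 x : x \in F -> a x = 0.
    by move=> xF; rewrite aE !(introF eqP) // => xE; move: uF vF; rewrite xE xF.
  move: wtE; rewrite aT !a0 ?FE ?inE ?eqxx ?orbT // -FE; move: lt l2; clear; lia.
Qed.

End Cuts.

Lemma disconnected_cut l : diam D = None -> 0 < l -> exists a A F1 F2, cut Phi l a A F1 F2.
Proof.
rewrite /diam; case: ifP => // /negbT con _ l0.
move: con; rewrite negb_forall => /existsP[u]; rewrite negb_forall => /existsP[v].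
rewrite !negb_imply => /and3P[uD vD nuv].
have [F1 fF1 uF1] := face_in_facet uD; rewrite sub1set in uF1.
have [F2 fF2 vF2] := face_in_facet vD; rewrite sub1set in vF2.
pose A := [set x | connect (edge D) u x].
have stay F x y : F \in Phi -> x \in F -> y \in F -> x \in A -> y \in A.
  move=> FP xF yF; rewrite !inE => ux; have [<- //|xy] := eqVneq x y.
  apply: connect_trans ux (connect1 _); rewrite /edge /= xy.
  by apply: face_sub (Phi_face FP) _; rewrite subUset !sub1set xF.
have F1P : F1 \in Phi by rewrite inE.
have F2P : F2 \in Phi by rewrite inE.
exists 0%MM, A, F1, F2; split; rewrite ?weight0 //.
- split.
    by apply/subsetP => x xF; apply: (stay F1 u) => //; rewrite inE connect0.
  apply/pred0P => x; apply/negP => /= /andP[xF xA].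
  by have := stay F2 x v F2P xF vF2 xA; rewrite inE (negbTE nuv).
- move=> F FP _; have [dis|/pred0Pn[x /andP[/= xF xA]]] := boolP [disjoint F & A].
    by right.
  by left; apply/subsetP => y yF; apply: (stay F x).
Qed.

End Graphs.

(** * Depth and S_2-depth in terms of cuts *)

Section Depths.
Variables (k : fieldType) (n : nat) (D : {set {set 'I_n}}).
Hypothesis hD : simplicial_complex D.
Hypothesis hdim : complex_dim D = 1%R.
Local Notation Phi := [set F | facet D F].
Local Notation J l := (symbolic_power (stanley_reisner k D) l).

Lemma cut_depth l : 0 < l -> (exists a A F1 F2, cut Phi l a A F1 F2) ->
  is_depth (J l) 1 /\ is_Sr_depth 2 (J l) 1.
Proof.
move=> l0 [a [A [F1 [F2 cutA]]]]; rewrite symbolic_powerE //.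
have P0 := Phi_neq0 hD hdim; have Pex := Phi_exists hD hdim.
split; last exact: (Sr_depth1 k l0 P0 cutA).
split; first by exists [:: (\sum_i 'X_i)%R] => //; apply: depth_ge1.
by move=> s; apply: depth_le1_seq; apply: (cut_H1 P0 cutA).
Qed.

Lemma no_cut_depth l : 0 < l -> (forall F, F \in Phi -> #|F| = 2) ->
  (forall a A F1 F2, ~ cut Phi l a A F1 F2) ->
  is_depth (J l) 2 /\ is_Sr_depth 2 (J l) 2.
Proof.
move=> l0 P2 nocut; rewrite symbolic_powerE //.
have P0 := Phi_neq0 hD hdim; have Pex := Phi_exists hD hdim.
have H1 : H1_vanishes (@face_ideal k n Phi l).
  by apply: no_cut_H1 => // F FP; rewrite P2.
have [u [v [uv uvD]]] := edge_exists hD hdim.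
have FP := edge_in_Phi hdim uv uvD.
split; last first.
  by apply: (Sr_depth2 l0 P0 FP (P2 _ FP)) => // G GP; rewrite P2.
split.
  by exists [:: \sum_i 'X_i; sum_faces k Phi]%R => //; apply: depth_ge2.
move=> s; apply: (depth_le2_seq l0 uv FP) => G GP FG.
by apply/esym/eqP; rewrite eqEcard FG (P2 _ GP) (P2 _ FP).
Qed.

End Depths.

Theorem corollary1p8 (k : fieldType) (n : nat) (D : {set {set 'I_n}})
    (hD : simplicial_complex D) (hdim : complex_dim D = 1%R) :
  [/\ (* (i) *)
      matroid_complex D ->
        forall l : nat, 1 <= l ->
          is_depth (symbolic_power (stanley_reisner k D) l) 2,
      (* (ii) *)
      forall d : nat, diam D = Some d -> d <= 2 -> ~ matroid_complex D ->
        forall l : nat, 1 <= l ->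
          is_depth (symbolic_power (stanley_reisner k D) l)
                   (if l <= 2 then 2 else 1),
      (* (iii) *)
      forall d : nat, diam D = Some d -> 3 <= d ->
        forall l : nat, 1 <= l ->
          is_depth (symbolic_power (stanley_reisner k D) l)
                   (if l <= 1 then 2 else 1),
      (* (iv) *)
      diam D = None ->
        forall l : nat, 1 <= l ->
          is_depth (symbolic_power (stanley_reisner k D) l) 1
    & (* moreover *)
      pure D ->
        forall l : nat, 1 <= l ->
          exists2 d : nat,
            is_depth (symbolic_power (stanley_reisner k D) l) d
            & is_Sr_depth 2 (symbolic_power (stanley_reisner k D) l) d].
Proof.
(* A connected complex with an edge has no isolated vertex, so its facets are edges. Isolated
   vertices can occur in case (iv), where [cut_depth] allows them. *)
have con2 d : diam D = Some d -> forall F, F \in [set F | facet D F] -> #|F| = 2.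
  by move=> /diam_connected con; apply: (facet_card2 hD hdim); apply: connected_nbr.
have pure2 : pure D -> forall F, F \in [set F | facet D F] -> #|F| = 2.
  by move=> pD; apply: (facet_card2 hD hdim); apply: pure_nbr.
split.
- move=> mD l l0; have c2 := pure2 (matroid_pure mD).
  apply: (proj1 (no_cut_depth k hD hdim l0 c2 _)) => a A F1 F2.
  exact: matroid_no_cut.
- move=> d diamD d2 nm l l0; have c2 := con2 d diamD; case: leqP => l2.
    apply: (proj1 (no_cut_depth k hD hdim l0 c2 _)) => a A F1 F2.
    exact: (diam_le2_no_cut hD hdim c2 diamD d2 l2).
  by apply: (proj1 (cut_depth k hD hdim l0 _)); apply: not_matroid_cut.
- move=> d diamD d3 l l0; have c2 := con2 d diamD; case: leqP => l2.
    apply: (proj1 (no_cut_depth k hD hdim l0 c2 _)) => a A F1 F2.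
    exact: (connected_no_cut hD hdim c2 (diam_connected diamD) l2).
  by apply: (proj1 (cut_depth k hD hdim l0 _)); exact: (diam_ge3_cut hD hdim c2 diamD d3 l2).
- move=> diamD l l0; apply: (proj1 (cut_depth k hD hdim l0 _)).
  exact: disconnected_cut.
- move=> pD l l0.
  (* Purity makes all facets edges, so the presence or absence of a cut decides both invariants at
     once, whatever the diameter. *)
  have [/(cut_depth k hD hdim l0)[]|nocut] :=
      classic (exists a A F1 F2, cut [set F | facet D F] l a A F1 F2); first by exists 1.
  have [] : is_depth (symbolic_power (stanley_reisner k D) l) 2 /\
      is_Sr_depth 2 (symbolic_power (stanley_reisner k D) l) 2.
    apply: no_cut_depth => //; first exact: pure2.
    by move=> a A F1 F2 cutA; apply: nocut; exists a, A, F1, F2.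
  by exists 2.
Qed.
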